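(* For $n\geq 1$ let $p_n$ be the probability that the subgroup of $\mathcal S_n$ generated by two permutations, chosen independently and uniformly at random from $\mathcal S_n$, is non-nudgable. Then $\liminf_{n\to\infty} p_n\geq \frac34$.
   Context: $\mathcal S_n$ denotes the group of all permutations of $\{1,\ldots,n\}$. For $\sigma\in\mathcal S_n$ the inversion set is $\mathrm{inv}(\sigma)=\{(i,j)\mid 1\leq i<j\leq n,\ \sigma(j)<\sigma(i)\}$. For a subgroup $G\subseteq\mathcal S_n$ and $\pi\in G$ put $D_G(\pi)=\{\sigma\in G\mid \mathrm{inv}(\sigma)\cap\mathrm{inv}(\pi)=\emptyset\}$. The subgroup $G\subseteq\mathcal S_n$ is called non-nudgable if $|D_G(\pi)|=|D_G(\pi^{-1})|$ for all $\pi\in G$; otherwise it is called nudgable. *)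

(* Defs.v *)
From mathcomp Require Import all_boot all_order all_algebra all_fingroup.
From mathcomp Require Import all_classical all_reals all_analysis.

Set Implicit Arguments.
Unset Strict Implicit.
Unset Printing Implicit Defensive.

Import Order.TTheory GRing.Theory Num.Theory GroupScope.

(* Permutations act on 'I_n = {0, ..., n-1} in place of {1, ..., n}; only the
   order of the points matters.  Orders between points are those of nat. *)
Definition inv_set (n : nat) (s : 'S_n) : {set 'I_n * 'I_n} :=
  [set ij : 'I_n * 'I_n | (ij.1 < ij.2)%N && (s ij.2 < s ij.1)%N].

Definition Dset (n : nat) (G : {group 'S_n}) (p : 'S_n) : {set 'S_n} :=
  [set s in G | inv_set s :&: inv_set p == finset.set0].

Definition non_nudgable (n : nat) (G : {group 'S_n}) : bool :=
  [forall p in G, #|Dset G p| == #|Dset G p^-1|].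

(* A pair of independent uniform permutations is uniform on 'S_n * 'S_n. *)
Definition prob_non_nudgable (R : realType) (n : nat) : R :=
  (#|[set st : 'S_n * 'S_n | non_nudgable <<[set st.1; st.2]>>%G]|%:R
   / #|{: 'S_n * 'S_n}|%:R)%R.

(* Main.v *)
(** A subgroup containing the order-reversing permutation [w] is non-nudgable:
    [s |-> p^-1 * s * w] maps D(p) bijectively to D(p^-1).  Hence it suffices that
    a random pair, unless both its members are even (probability 1/4), almost
    surely generates the whole symmetric group (Dixon).  A union bound over
    subsets and over uniform partitions makes the generated group almost surely
    transitive and primitive.  By a second moment computation over the primes in
    a window from about (log n)^(3/2) to sqrt n, the first permutation almost
    surely has a cycle of prime length p < sqrt n and no other cycle length
    divisible by p, so that one of its powers is a p-cycle.  By Jordan's theorem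
    the group is then 2-transitive; as p^2 < n, some conjugate of the p-cycle
    meets its support in a single point, so their commutator is a 3-cycle, and
    the group contains the alternating group. *)
Require Import Defs.
From mathcomp Require Import all_boot all_order all_algebra all_fingroup.
From mathcomp Require Import cyclic primitive_action alt zify ring lra.

Set Implicit Arguments.
Unset Strict Implicit.
Unset Printing Implicit Defensive.

Import Order.TTheory GRing.Theory Num.Theory.

(** * Three-cycles *)

Section PermutationGroups.
Local Open Scope group_scope.
Variable T : finType.
Implicit Types (s t g h x y : {perm T}) (a b c d e : T) (A B D S : {set T}) (G : {group {perm T}}).

(** The exponent 3/2 settles two opposing demands on the lower end [L] of the window. A resonance,
    that is a second cycle whose length is divisible by the prime, has probability at most the sum
    of [1/p^2] over the window times a harmonic sum, about [log n / L]; so [L] must outgrow [log n].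
    On the other hand the sum of [1/p] over the window must be unbounded for the cycle to exist
    almost surely. In place of Mertens' theorem, the Euler product is compared with the harmonic
    sum: up to about [sqrt n] it is at least of order [log n], and up to [L] it is at most
    [2 * sqrt L] by an elementary estimate. The factor left to the window is therefore unbounded as
    soon as [L] is of smaller order than [(log n)^2]. The choice [(log n)^(3/2)] lies between the
    two constraints. *)

Lemma mem_imset_perm s A a : (a \in s @: A) = (s^-1 a \in A).
Proof. by rewrite -[in LHS](permKV s a) mem_imset //; exact: perm_inj. Qed.

Lemma card_imset_perm s A : #|s @: A| = #|A|.
Proof. by rewrite card_imset //; exact: perm_inj. Qed.

Lemma imset_permM s t A : (s * t) @: A = t @: (s @: A).
Proof. by apply/setP=> a; rewrite !mem_imset_perm invMg permM. Qed.

Lemma imset_permK s A : s^-1 @: (s @: A) = A.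
Proof. by apply/setP=> a; rewrite !mem_imset_perm invgK permK. Qed.

(** Products act from left to right, so for distinct points this is [a -> b -> c -> a]. *)
Definition cycle3 a b c := tperm a b * tperm a c.

#[local] Hint Extern 0 (is_true (negb (eq_op _ _))) => solve [rewrite eq_sym; assumption] : core.

Lemma cycle3J a b c s : cycle3 a b c ^ s = cycle3 (s a) (s b) (s c).
Proof. by rewrite /cycle3 conjMg !tpermJ. Qed.

Lemma cycle3V a b c : (cycle3 a b c)^-1 = cycle3 a c b.
Proof. by rewrite /cycle3 invMg !tpermV. Qed.

Lemma cycle3_fst a b c : a != b -> b != c -> cycle3 a b c a = b.
Proof. by move=> ab bc; rewrite permM tpermL tpermD. Qed.
Lemma cycle3_snd a b c : cycle3 a b c b = c.
Proof. by rewrite permM tpermR tpermL. Qed.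
Lemma cycle3_trd a b c : a != c -> b != c -> cycle3 a b c c = a.
Proof. by move=> ac bc; rewrite permM (@tpermD _ a b) ?tpermR. Qed.
Lemma cycle3_fix a b c d : a != d -> b != d -> c != d -> cycle3 a b c d = d.
Proof. by move=> ad bd cd; rewrite permM !tpermD. Qed.

Lemma cycle3_rot a b c : a != b -> b != c -> a != c -> cycle3 a b c = cycle3 b c a.
Proof.
move=> ab bc ac; apply/permP=> d.
have [->|ad] := eqVneq d a; first by rewrite cycle3_fst // cycle3_trd.
have [->|bd] := eqVneq d b; first by rewrite cycle3_snd cycle3_fst.
have [->|cd] := eqVneq d c; first by rewrite cycle3_trd // cycle3_snd.
by rewrite !cycle3_fix.
Qed.

Section ThreeCycles.
Variable G : {group {perm T}}.

Lemma cycle3_mem_sym a b c : (cycle3 a b c \in G) = (cycle3 a c b \in G).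
Proof. by rewrite -cycle3V groupV. Qed.

(** Conjugating [(a c d)] by [(a b c)] gives [(b a d)], the inverse of [(a b d)]. *)
Lemma cycle3_mem_trans a b c d : uniq [:: a; b; c; d] ->
  cycle3 a b c \in G -> cycle3 a c d \in G -> cycle3 a b d \in G.
Proof.
rewrite /= !inE !negb_or !andbT => /andP[/and3P[ab ac ad] /andP[/andP[bc bd] cd]].
move=> Gabc Gacd; have := groupJ Gacd Gabc.
by rewrite cycle3J cycle3_fst // cycle3_trd // cycle3_fix // cycle3_mem_sym (@cycle3_rot a b d).
Qed.

(** Conjugating [(a d e)] by [(a b c)] gives [(b d e)], and [(a d e) * (b d e)^-1 = (a b e)]. *)
Lemma cycle3_mem_split a b c d e : uniq [:: a; b; c; d; e] ->
  cycle3 a b c \in G -> cycle3 a d e \in G -> cycle3 a b e \in G.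
Proof.
rewrite /= !inE !negb_or !andbT => /and4P[/and4P[ab ac ad ae] /and3P[bc bd be] /andP[cd ce] de].
move=> Gabc Gade; have := groupJ Gade Gabc.
rewrite cycle3J cycle3_fst // !cycle3_fix // => Gbde.
suff <- : cycle3 a d e * (cycle3 b d e)^-1 = cycle3 a b e by rewrite groupM ?groupV.
rewrite cycle3V; apply/permP=> z; rewrite permM.
have [->|az] := eqVneq z a; first by rewrite !cycle3_fst // cycle3_trd.
have [->|bz] := eqVneq z b; first by rewrite (@cycle3_fix a) // cycle3_fst // cycle3_snd.
have [->|dz] := eqVneq z d; first by rewrite !cycle3_snd (@cycle3_fix a).
have [->|ez] := eqVneq z e; first by rewrite (@cycle3_trd a d) // cycle3_fix // cycle3_trd.
by rewrite !cycle3_fix.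
Qed.

(** Take [(a b b')] and [(a c c')] in [G]. When [b' = c'], [cycle3_mem_trans] combines the first
    with [(a c' c)], the inverse of the second; when all five points differ, [cycle3_mem_split]
    first replaces [b'] by [c']. *)
Lemma all_cycle3_mem :
  (forall a b, a != b -> exists2 c, (c != a) && (c != b) & cycle3 a b c \in G) ->
  forall a b c, uniq [:: a; b; c] -> cycle3 a b c \in G.
Proof.
move=> ex a b c; rewrite /= !inE !negb_or !andbT => /andP[/andP[ab ac] bc].
have [b' /andP[b'a b'b] Gb] := ex a b ab.
have [c' /andP[c'a c'c] Gc] := ex a c ac.
have [<-//|b'c] := eqVneq b' c.
have [<-|c'b] := eqVneq c' b; first by rewrite cycle3_mem_sym.
have Gc' : cycle3 a c' c \in G by rewrite cycle3_mem_sym.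
have [eb|b'c'] := eqVneq b' c'.
  by rewrite eb in Gb b'b; apply: (@cycle3_mem_trans a b c' c); rewrite //= !inE !negb_or !andbT; do ?[apply/andP; split].
apply: (@cycle3_mem_trans a b c' c) => //.
  by rewrite /= !inE !negb_or !andbT; do ?[apply/andP; split].
apply: (@cycle3_mem_split a b b' c c') => //.
by rewrite /= !inE !negb_or !andbT; do ?[apply/andP; split].
Qed.

Lemma tperm2_mem : (forall a b c, uniq [:: a; b; c] -> cycle3 a b c \in G) ->
  forall a b c d, a != b -> c != d -> tperm a b * tperm c d \in G.
Proof.
move=> Gt.
have share a b c : a != b -> a != c -> tperm a b * tperm a c \in G.
  move=> ab ac; have [<-|bc] := eqVneq b c; first by rewrite tperm2 group1.
  by apply: Gt; rewrite /= !inE !negb_or ab ac bc.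
move=> a b c d ab cd.
move: cd; have [<-|ac] := eqVneq a c => cd; first exact: share.
have -> : tperm a b * tperm c d = (tperm a b * tperm a c) * (tperm a c * tperm c d).
  by rewrite -mulgA (mulgA (tperm a c)) tperm2 mul1g.
by rewrite groupM ?share // [tperm a c]tpermC share // eq_sym.
Qed.

Lemma generates_Sym : (forall a b c, uniq [:: a; b; c] -> cycle3 a b c \in G) ->
  (exists2 g, g \in G & odd_perm g) -> forall s, s \in G.
Proof.
move=> /tperm2_mem Gt [g Gg og].
have gn1 : exists xy : T * T, xy.1 != xy.2.
  have [[|xy ts]] := prod_tpermP g; first by rewrite big_nil => g1; rewrite g1 odd_perm1 in og.
  by move=> _ /andP[xyd _]; exists xy.
case: gn1 => -[x y] /= xy; pose t := tperm x y.
(* Consecutive transpositions are paired along a factorisation of [s], the fixed [t] completing an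
   unfinished pair. The odd element [g] then forces [t] itself into [G]. *)
have H s : if odd_perm s then t * s \in G else s \in G.
  have [ts -> {s}] := prod_tpermP s.
  elim: ts => [_|[z w] ts IH /= /andP[zw /IH{}IH]]; first by rewrite big_nil odd_perm1 group1.
  rewrite big_cons odd_mul_tperm /=; move: zw IH; rewrite /dpair /= => zw; rewrite zw /=.
  case: odd_perm => /= Gs; last by rewrite mulgA groupM ?Gt.
  set P := bigop.body _ _ _ in Gs *.
  have -> : tperm z w * P = (tperm z w * t) * (t * P) by rewrite mulgA -(mulgA _ t t) tperm2 mulg1.
  by rewrite groupM ?Gt.
have Gtt : t \in G by have := H g; rewrite og groupMr.
by move=> s; move: (H s); case: odd_perm; rewrite ?groupMl.
Qed.
End ThreeCycles.
End PermutationGroups.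

(** * Jordan's theorem on primitive groups with a prime cycle *)

Section Jordan.
Local Open Scope group_scope.
Variable T : finType.
Implicit Types (s t g h x y : {perm T}) (a b c d e : T) (A B D E S : {set T}).
Variable G : {group {perm T}}.
#[local] Hint Extern 0 (is_true (negb (eq_op _ _))) => solve [rewrite eq_sym; assumption] : core.

Definition fixes_outside D h := forall z, z \notin D -> h z = z.

Lemma fixes_outside1 D : fixes_outside D 1.
Proof. by move=> z _; rewrite perm1. Qed.

Lemma fixes_outsideM D h k : fixes_outside D h -> fixes_outside D k -> fixes_outside D (h * k).
Proof. by move=> fh fk z zD; rewrite permM fh ?fk. Qed.

Lemma fixes_outsideV D h : fixes_outside D h -> fixes_outside D h^-1.
Proof. by move=> fh z zD; rewrite -{1}(fh z zD) permK. Qed.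

Lemma fixes_outsideS D E h : D \subset E -> fixes_outside D h -> fixes_outside E h.
Proof. by move=> /subsetP sDE fh z zE; apply: fh; apply: contra zE; apply: sDE. Qed.

Lemma fixes_outsideJ D h g : fixes_outside D h -> fixes_outside (g @: D) (h ^ g).
Proof.
move=> fh z; rewrite mem_imset_perm => zD.
by rewrite conjgE !permM fh // permKV.
Qed.

(** Rudio's property of primitive groups, asked of the elements of [G] that fix every point outside
    [D]. It stands in for primitivity on [D]: it is easily checked for a cycle of prime length, it
    follows from 2-transitivity, and the extension step applies it directly to a difference
    [g @: D :\: D]. *)
Definition separating D := forall S a b, S \subset D -> S != set0 -> S != D ->
  a \in D -> b \in D -> a != b ->
  exists2 h, h \in G & [/\ fixes_outside D h, a \in h @: S & b \notin h @: S].

Definition pair_transitive D := forall a b c d, a \in D -> b \in D -> c \in D -> d \in D ->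
  a != b -> c != d -> exists2 h, h \in G & [/\ fixes_outside D h, h a = c & h b = d].

(** Primitivity. On more than two points this contains transitivity, since otherwise a nontrivial
    orbit, or two fixed points, would violate it. *)
Definition no_blocks := forall B, 1 < #|B| < #|T| ->
  exists2 g, g \in G & (g @: B != B) && (g @: B :&: B != set0).

Lemma pair_transitive_separating D : pair_transitive D -> separating D.
Proof.
move=> pD S a b SD /set0Pn[s sS] SnD aD bD ab.
have /subsetPn[t tD tS] : ~~ (D \subset S) by apply: contra SnD => DS; rewrite eqEsubset SD.
have [h Gh [fh hs ht]] := pD s t a b (subsetP SD s sS) tD aD bD (memPn tS s sS) ab.
exists h => //; split=> //; first by rewrite -hs imset_f.
by rewrite -ht mem_imset //; exact: perm_inj.
Qed.

Lemma separating_trans D a b : separating D -> 1 < #|D| -> a \in D -> b \in D ->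
  exists2 h, h \in G & fixes_outside D h /\ h a = b.
Proof.
move=> sD D1 aD bD.
have /subsetPn[c cD cb] : ~~ (D \subset [set b]).
  by apply/negP=> /subset_leq_card; rewrite cards1; lia.
have aS : [set a] != set0 by apply/set0Pn; exists a; rewrite inE.
have aD' : [set a] != D by apply: contraTneq D1 => <-; rewrite cards1.
have bc : b != c by rewrite eq_sym; rewrite inE in cb.
have [|h Gh [fh ha _]] := sD [set a] b c _ aS aD' bD cD bc; first by rewrite sub1set.
by exists h => //; split=> //; move: ha; rewrite imset_set1 inE => /eqP.
Qed.

Lemma separatingJ D g : g \in G -> separating D -> separating (g @: D).
Proof.
move=> Gg sD S a b SD S0 SnD aD bD ab.
have [||||||h Gh [fh ah bh]] := sD (g^-1 @: S) (g^-1 a) (g^-1 b).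
- by apply/subsetP=> u; rewrite mem_imset_perm invgK => /(subsetP SD); rewrite mem_imset_perm permK.
- by rewrite -card_gt0 card_imset_perm card_gt0.
- by apply: contra SnD => /eqP <-; rewrite -{1}(invgK g) imset_permK.
- by rewrite -mem_imset_perm.
- by rewrite -mem_imset_perm.
- by rewrite (inj_eq perm_inj).
exists (h ^ g); first by rewrite groupJ.
split; first exact: fixes_outsideJ.
  by move: ah; rewrite conjgE !imset_permM [a \in _]mem_imset_perm.
by move: bh; rewrite conjgE !imset_permM [b \in _]mem_imset_perm.
Qed.

(** A translate [g @: D] that meets [D], differs from it and has fewest points outside it has
    exactly one such point [z]. Elements supported on [D] and on [g @: D] together bring any point
    of [z |: D] to [z]; those supported on [D] fix [z] and are transitive on [D]. Hence
    2-transitivity on [z |: D]. *)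
Lemma jordan_step D : separating D -> no_blocks -> 1 < #|D| < #|T| ->
  exists2 D' : {set T}, #|D'| = #|D|.+1 & pair_transitive D'.
Proof.
move=> sD nb D1.
pose P g := [&& g \in G, g @: D != D & g @: D :&: D != set0].
have [g0 Gg0 Pg0] := nb D D1.
have {}Pg0 : P g0 by rewrite /P Gg0.
have [g /and3P[Gg gD gDi] gmin] := @arg_minnP _ g0 P (fun g => #|g @: D :\: D|) Pg0.
have /subsetPn[z zg zD] : ~~ (g @: D \subset D).
  by apply: contra gD => gD; rewrite eqEcard gD card_imset_perm leqnn.
(* Two points of [g @: D :\: D] could be separated by some [h] supported on
   [g @: D]; then [h @: D] would overlap [D] more than [g @: D] does. *)
have gz : g @: D :\: D = [set z].
  apply/eqP; rewrite eq_sym eqEcard cards1 sub1set inE zg zD /=.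
  rewrite leqNgt; apply/negP=> /card_gt1P[a [b [aE bE ab]]].
  have [ag aD] := setDP aE.
  have [bg bD] := setDP bE.
  have [|||h Gh [fh ah bh]] := separatingJ Gg sD _ _ _ ag bg ab (S := g @: D :\: D).
  - exact: subsetDl.
  - by apply/set0Pn; exists z; rewrite inE zg zD.
  - apply: contra gDi => /eqP SD; rewrite -SD; apply/eqP/setP=> u; rewrite !inE.
    by case: (u \in D); rewrite ?andbF.
  have aH : a \notin h @: D by move: ah; rewrite !mem_imset_perm inE => /andP[].
  have bH : b \in h @: D.
    rewrite mem_imset_perm; apply: contraNT bh => bh; rewrite mem_imset_perm inE bh /=.
    by apply: contraT => bg'; have := fh _ bg'; rewrite permKV => e; rewrite -e bg in bg'.
  have /subsetPn[y yD yg] : ~~ (D \subset g @: D).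
    by apply: contra gD => Dg; rewrite eq_sym eqEcard Dg card_imset_perm leqnn.
  have /gmin : P h.
    apply/and3P; split=> //; first by apply: contraNneq bD => <-.
    by apply/set0Pn; exists y; rewrite inE yD -{1}(fh y yg) imset_f.
  apply/negP; rewrite -ltnNge; apply: proper_card; apply/properP; split; last first.
    by exists a => //; rewrite inE (negPf aH) andbF.
  apply/subsetP=> u /setDP[uh uD]; rewrite inE uD /=.
  apply: contraT => ug; move: uh; rewrite mem_imset_perm.
  by rewrite (fixes_outsideV fh ug) (negPf uD).
have [d dg dD] : exists2 d, d \in g @: D & d \in D by move/set0Pn: gDi => [d /setIP[? ?]]; exists d.
have [D1' _] := andP D1.
exists (z |: D); first by rewrite cardsU1 zD.
have gDs : g @: D \subset z |: D.
  apply/subsetP=> u ug; rewrite in_setU1; case uD: (u \in D); first by rewrite orbT.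
  by have: u \in [set z] by [rewrite -gz inE uD ug]; rewrite inE => ->.
(* Elements supported on [D] bring [a] to the common point [d], from which elements supported on
   [g @: D] reach [z]. *)
have toz a : a \in z |: D -> exists2 h, h \in G & fixes_outside (z |: D) h /\ h a = z.
  rewrite in_setU1 => /orP[/eqP ->|aD].
    by exists 1 => //; split; [exact: fixes_outside1 | rewrite perm1].
  have [h Gh [fh ha]] := separating_trans sD D1' aD dD.
  have [|k Gk [fk kd]] := separating_trans (separatingJ Gg sD) _ dg zg; first by rewrite card_imset_perm.
  exists (h * k); first exact: groupM.
  split; last by rewrite permM ha.
  by apply: fixes_outsideM; [apply: fixes_outsideS fh; exact: subsetUr | exact: fixes_outsideS fk].
have toz2 b0 a b : b0 \in D -> a \in z |: D -> b \in z |: D -> a != b ->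
    exists2 h, h \in G & [/\ fixes_outside (z |: D) h, h a = z & h b = b0].
  move=> b0D aD bD ab; have [h Gh [fh ha]] := toz a aD.
  have hbD : h b \in D.
    have hbz : h b != z by rewrite -ha (inj_eq perm_inj).
    apply: contraTT bD => hbD.
    have hbf : h b \notin z |: D by rewrite in_setU1 negb_or hbz.
    by have := fixes_outsideV fh hbf; rewrite permK => ->.
  have [k Gk [fk kb]] := separating_trans sD D1' hbD b0D.
  exists (h * k); first exact: groupM.
  split; [|by rewrite permM ha fk|by rewrite permM kb].
  by apply: fixes_outsideM => //; apply: fixes_outsideS fk; exact: subsetUr.
move=> a b c e aD bD cD eD ab ce.
have [h Gh [fh ha hb]] := toz2 d a b dD aD bD ab.
have [k Gk [fk kc ke]] := toz2 d c e dD cD eD ce.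
exists (h * k^-1); first by rewrite groupM ?groupV.
split; first by apply: fixes_outsideM => //; exact: fixes_outsideV.
  by rewrite permM ha -kc permK.
by rewrite permM hb -ke permK.
Qed.

Lemma jordan D : separating D -> no_blocks -> 1 < #|D| < #|T| -> pair_transitive setT.
Proof.
move=> + nb; have [m] := ubnP (#|T| - #|D|).
elim: m => // m IH in D *; rewrite ltnS => leDm sD D1.
have [D' cD' pD'] := jordan_step sD nb D1.
have [ltD'|geD'] := ltnP #|D'| #|T|.
  by apply: IH (pair_transitive_separating pD') _; rewrite cD'; lia.
suff -> : [set: T] = D' by [].
by apply/eqP; rewrite eq_sym eqEcard subsetT cardsT.
Qed.

Lemma porbit_prime_order x a : prime #|porbit x a| -> fixes_outside (porbit x a) x ->
  #[x] = #|porbit x a|.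
Proof.
move=> p_pr fx; apply/(prime_nt_dvdP p_pr).
  rewrite order_eq1; apply: contraTneq p_pr => ->.
  suff -> : porbit 1 a = [set a] by rewrite cards1.
  by apply/setP=> u; rewrite inE; apply/porbitP/eqP => [[i ->]|->]; [rewrite expg1n perm1 | exists 0; rewrite perm1].
rewrite order_dvdn; apply/eqP/permP=> z; rewrite perm1.
have [/porbitP[i ->]|zD] := boolP (z \in porbit x a).
  have e : (x ^+ #|porbit x a|) a = a by rewrite permX iter_porbit.
  by rewrite -permM -expgD addnC expgD permM e.
by elim: #|_| => [|m IH]; rewrite ?expg0 ?perm1 // expgS permM fx.
Qed.

(** Suppose every translate of [S] under a power of [x] that contains [b] also contains
    [c = (x ^+ d) b]. Then [S] is closed under [x ^+ d], which generates [<[x]>] because the order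
    is prime, so [S] is the whole cycle. *)
Lemma prime_cycle_separating x a : x \in G -> prime #|porbit x a| ->
  fixes_outside (porbit x a) x -> separating (porbit x a).
Proof.
move=> Gx p_pr fx S b c SD /set0Pn[s sS] SnD bD cD bc.
have ox := porbit_prime_order p_pr fx.
have bP : porbit x b = porbit x a by apply/eqP; rewrite eq_porbit_mem.
have [d ed] : exists d : nat, c = (x ^+ d) b by apply/porbitP; rewrite bP.
have fxX i : fixes_outside (porbit x a) (x ^+ i).
  by elim: i => [|i IH]; [exact: fixes_outside1 | rewrite expgS; apply: fixes_outsideM].
case: (boolP [exists i : 'I_#[x], (b \in (x ^+ i) @: S) && (c \notin (x ^+ i) @: S)]).
  by case/existsP=> i /andP[bS cS]; exists (x ^+ i) => //; exact: groupX.
rewrite negb_exists => /forallP H.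
have {}H i : b \in (x ^+ i) @: S -> c \in (x ^+ i) @: S.
  move=> bS; have := H (Ordinal (ltn_pmod i (order_gt0 x))); rewrite /= expg_mod_order negb_and negbK.
  by rewrite bS.
pose y := x ^+ d.
have clo u : u \in S -> y u \in S.
  move=> uS; have : b \in porbit x u.
    by rewrite porbit_sym bP (subsetP SD).
  case/porbitP=> i eb; have: b \in (x ^+ i) @: S by rewrite eb imset_f.
  move/H; rewrite ed eb -/y -permM /y -expgD addnC expgD permM.
  by rewrite mem_imset //; exact: perm_inj.
have xy : x \in <[y]>.
  have y1 : y != 1 by apply: contraNneq bc => y1; rewrite ed -/y y1 perm1.
  suff -> : <[y]> = <[x]> by exact: cycle_id.
  apply/eqP; rewrite eqEcard cycleX /= -!orderE.
  have /(prime_nt_dvdP p_pr) -> : #[y] %| #|porbit x a| by rewrite -ox orderXdvd.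
    by rewrite ox.
  by rewrite order_eq1.
case/negP: SnD; rewrite eqEsubset SD /=; apply/subsetP=> u uD.
have : u \in porbit x s.
  suff -> : porbit x s = porbit x a by [].
  by apply/eqP; rewrite eq_porbit_mem (subsetP SD).
case/porbitP=> i ->; have [j ->] := cycleP _ _ xy.
rewrite -expgM; elim: (j * i)%N => [|k IH]; first by rewrite perm1.
by rewrite expgSr permM clo.
Qed.

(* The average of [#|A :&: k @: A|] over [K] is [#|A| ^ 2 / #|S|], less than 1. *)
Lemma transitive_avoid (K : {group {perm T}}) S A : A \subset S ->
  (forall u v, u \in S -> v \in S -> exists2 k, k \in K & k u = v) ->
  #|A| ^ 2 < #|S| -> exists2 k, k \in K & [disjoint A & k @: A].
Proof.
move=> AS tr ltA.
case: (boolP [exists k in K, [disjoint A & k @: A]]) => [/exists_inP[k]|]; first by exists k.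
rewrite negb_exists => /forallP H.
have le1 (k : {perm T}) : k \in K -> 1 <= \sum_(u in A) \sum_(v in A) (k u == v).
  move=> Kk; have := H k; rewrite Kk /= disjoint_sym => /pred0Pn[v /andP[/imsetP[u uA ->] kuA]].
  by rewrite (bigD1 u) //= (bigD1 (k u)) //= eqxx.
have cnt u v : u \in A -> #|S| * \sum_(k in K) (k u == v) <= #|K|.
  move=> uA; rewrite -sum1_card -(card_orbit_stab 'P K u) sum1_card.
  have [k0 /andP[Kk0 /eqP k0u]|no] := pickP [pred k in K | k u == v]; last first.
    rewrite big1 ?muln0 // => k Kk; have := no k; rewrite /= Kk /= => ->.
    by [].
  apply: leq_mul.
    apply: subset_leq_card; apply/subsetP=> w wS.
    have [k Kk kw] := tr u w (subsetP AS u uA) wS.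
    by rewrite -kw; exact: (mem_orbit 'P u Kk).
  rewrite -big_mkcondr /= sum1_card -(card_rcoset _ k0) -amove_act //=.
  apply: subset_leq_card; apply/subsetP=> k /andP[Kk /eqP kuv].
  by apply/setIdP; split=> //=; rewrite /aperm kuv k0u.
have : \sum_(k in K) 1 <= \sum_(k in K) \sum_(u in A) \sum_(v in A) (k u == v) by exact: leq_sum.
rewrite sum1_card exchange_big /= => leK.
have : #|S| * #|K| <= #|A| ^ 2 * #|K|.
  apply: leq_trans (_ : #|S| * \sum_(u in A) \sum_(k in K) \sum_(v in A) (k u == v) <= _); first by rewrite leq_mul2l leK orbT.
  rewrite big_distrr /= expnS expn1 -mulnA -sum_nat_const; apply: leq_sum => u uA.
  rewrite exchange_big big_distrr /= -sum_nat_const; apply: leq_sum => v vA.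
  exact: cnt.
by rewrite leq_pmul2r ?cardG_gt0 // leqNgt ltA.
Qed.
End Jordan.

(** * From a short prime cycle to the symmetric group *)

Section Criterion.
Local Open Scope group_scope.
Variable T : finType.
Implicit Types (s t g h x y : {perm T}) (a b c d e : T) (A B D E S : {set T}).
Variable G : {group {perm T}}.
#[local] Hint Extern 0 (is_true (negb (eq_op _ _))) => solve [rewrite eq_sym; assumption] : core.

(** On [D] only [a] is moved by [y], so conjugation by [y] changes [x] just as the transposition [t]
    of [a] and [y a] does. The commutator is then [x^-1 * t * x * t], the product of the
    transposition of [x a] and [y a] with [t]. *)
Lemma commutator_cycle3 x y D E a : fixes_outside D x -> fixes_outside E y ->
  D :&: E = [set a] -> y a != a -> [~ x, y] = cycle3 (y a) (x a) a.
Proof.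
move=> fx fy DE ya.
have /setIP[aD aE] : a \in D :&: E by rewrite DE inE.
have yaE : y a \in E.
  by apply: contraNT ya => yaE; have := fixes_outsideV fy yaE; rewrite permK => <-.
have yaD : y a \notin D.
  by apply: contra ya => yaD; have : y a \in D :&: E by [rewrite inE yaD]; rewrite DE inE.
pose t := tperm a (y a).
have xyt : x ^ (y * t) = x.
  apply/conjg_fixP/commgP; apply: (@perm_onC _ D (~: D)); first by apply/subsetP=> u; rewrite inE; apply: contraR => /fx ->.
    apply/subsetP=> u; rewrite !inE; apply: contraNN => uD; rewrite permM.
    have [->|ua] := eqVneq u a; first by rewrite tpermR.
    have uE : u \notin E.
      by apply: contra ua => uE; have : u \in D :&: E by [rewrite inE uD]; rewrite DE inE.
    by rewrite fy // tpermD //; apply: contraNneq yaD => ->.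
  by rewrite disjoints_subset setCK.
have xy : x ^ y = t * x * t.
  have <- : x ^ t = t * x * t by rewrite conjgE tpermV mulgA.
  by rewrite -{2}xyt -conjgM -mulgA tperm2 mulg1.
rewrite commgEl xy mulgA mulgA -[x^-1 * t * x]mulgA -conjgE tpermJ (fx (y a)) //.
by rewrite /cycle3 [tperm (x a) _]tpermC /t [tperm a _]tpermC.
Qed.

Lemma sym_criterion x a g : x \in G -> prime #|porbit x a| ->
  fixes_outside (porbit x a) x -> no_blocks G ->
  #|porbit x a|.-1 ^ 2 < #|T|.-1 -> g \in G -> odd_perm g -> forall s, s \in G.
Proof.
move=> Gx p_pr fx nb ltpn Gg og; set D := porbit x a in fx p_pr ltpn.
have p1 := prime_gt1 p_pr.
have Dn : 1 < #|D| < #|T| by rewrite p1 /=; move: ltpn p1; case: #|D| => [|[|m]] //=; nia.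
have pT := jordan (prime_cycle_separating Gx p_pr fx) nb Dn.
have aD : a \in D by exact: porbit_id.
have xa : x a != a.
  apply: contraTneq p1 => xa; rewrite -leqNgt -(cards1 a) subset_leq_card //.
  apply/subsetP=> u /porbitP[i ->]; rewrite inE; elim: i => [|i IH]; first by rewrite perm1.
  by rewrite expgS permM xa.
have xaD : x a \in D by exact: (mem_porbit x 1).
(* By 2-transitivity the stabiliser of [a] is transitive on the remaining [#|T|.-1] points, and the
   size hypothesis is what [transitive_avoid] needs for the [p - 1] points of [D] other than [a]. *)
have [k Kk dis] : exists2 k, k \in 'C_G[a | 'P] & [disjoint D :\ a & k @: (D :\ a)].
  apply: (@transitive_avoid _ _ (~: [set a])).
  - by apply/subsetP=> u; rewrite !inE => /andP[].
  - move=> u v; rewrite !inE => ua va.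
    have [||h Gh [_ ha hu]] := pT a u a v (in_setT _) (in_setT _) (in_setT _) (in_setT _) => //.
    by exists h => //; apply/setIP; split=> //; apply/astab1P.
  - by rewrite (cardsD1 a D) aD cardsC1 in ltpn *.
have [Gk /astab1P] := setIP Kk; rewrite /= /aperm => ka.
have DE : D :&: k @: D = [set a].
  apply/setP=> u; rewrite !inE; apply/andP/eqP => [[uD ukD]|->]; last first.
    by rewrite -{2}ka imset_f.
  apply/eqP/negPn/negP=> ua; have /pred0P/(_ u)/negP[] := dis.
  rewrite /= !inE ua uD /= mem_imset_perm !inE -mem_imset_perm ukD andbT.
  by apply: contra ua => /eqP e; rewrite -(permKV k u) e ka.
have ya : (x ^ k) a = k (x a) by rewrite -{1}ka permJ.
have yna : (x ^ k) a != a by rewrite ya -{2}ka (inj_eq perm_inj).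
have := commutator_cycle3 fx (fixes_outsideJ (g := k) fx) DE yna.
set b := x a; set c := (x ^ k) a => cE.
have Gt : cycle3 c b a \in G by rewrite -cE groupR // groupJ.
have bc : b != c.
  apply: contraNneq xa => bc; have : b \in D :&: k @: D by rewrite inE xaD bc /c ya imset_f.
  by rewrite DE inE.
apply: generates_Sym; last by exists g.
apply: all_cycle3_mem => u v uv.
(* Conjugating the one 3-cycle found, 2-transitivity puts a 3-cycle through every ordered pair. *)
have [||h Gh [_ hc hb]] := pT c b u v (in_setT _) (in_setT _) (in_setT _) (in_setT _) => //.
exists (h a); last by rewrite -hc -hb -cycle3J groupJ.
by rewrite -hc -hb !(inj_eq perm_inj) andbC; apply/andP; split; rewrite eq_sym.
Qed.
End Criterion.

(** * Actions of random pairs *)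

Section Powers.
Local Open Scope group_scope.
Variable T : finType.

Lemma porbit_period (s : {perm T}) a k : #|porbit s a| %| k -> (s ^+ k) a = a.
Proof.
move=> /dvdnP[m ->]; rewrite mulnC expgM permX.
by elim: m => //= m ->; rewrite permX iter_porbit.
Qed.

(** The exponent is a product of the lengths of all other cycles, each repeated once per point: it
    kills these cycles and, being prime to [p], only permutes the powers of [s] along the cycle of
    [a]. *)
Lemma isolated_prime_cycle (s : {perm T}) a : prime #|porbit s a| ->
  (forall z, z \notin porbit s a -> ~~ (#|porbit s a| %| #|porbit s z|)) ->
  exists2 k, porbit (s ^+ k) a = porbit s a & fixes_outside (porbit s a) (s ^+ k).
Proof.
move=> p_pr H; pose k := (\prod_(z | z \notin porbit s a) #|porbit s z|)%N.
exists k; last first.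
  move=> z zD; apply: porbit_period; rewrite /k (bigD1 z) //=; exact: dvdn_mulr.
have cop : coprime k #|porbit s a|.
  rewrite coprime_sym prime_coprime // /k; elim/big_rec: _ => [|z m zD IH].
    by rewrite dvdn1 neq_ltn prime_gt1 ?orbT.
  by rewrite Euclid_dvdM // negb_or H.
have k0 : 0 < k by rewrite prodn_cond_gt0 // => z _; rewrite lt0n card_porbit_neq0.
case: (egcdnP #|porbit s a| k0) => u v e _.
apply/setP=> z; apply/idP/idP => [/porbitP[i ->]|/porbitP[i ->]].
  by rewrite -expgM mem_porbit.
suff -> : (s ^+ i) a = ((s ^+ k) ^+ (u * i)) a by exact: mem_porbit.
move: cop; rewrite /coprime => /eqP cop.
rewrite -expgM mulnA (mulnC k) e cop mulnDl mul1n expgD permM.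
by rewrite (@porbit_period s a (_ * _)) // mulnAC dvdn_mull.
Qed.
End Powers.

Section NonNudgable.
Local Open Scope group_scope.

(** The pairs [(i, j)] inverted by [p^-1] correspond to the pairs [(p^-1 j, p^-1 i)] inverted by
    [p]. This swaps the two entries, and [w] reverses the order of their images, so [f s] inverts
    the first pair exactly when [s] inverts the second. *)
Lemma non_nudgable_setT n : non_nudgable [set: 'S_n]%G.
Proof.
apply/forall_inP=> p _; apply/eqP.
pose w : 'S_n := perm (@rev_ord_inj n).
pose f (s : 'S_n) := p^-1 * s * w.
have f_inj : injective f by move=> s t /mulIg/mulgI.
rewrite -(card_imset _ f_inj); apply: eq_card => t.
have -> : t = f (p * t * w^-1) by rewrite /f !mulgA mulVg mul1g mulgKV.
rewrite mem_imset //; move: (p * t * _) => {t} s.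
rewrite !inE /=; apply/eqP/eqP => H; apply/setP=> -[i j]; rewrite !inE /=; apply/negP.
- case/andP=> /andP[ij fs] /andP[_ ps].
  have := in_set0 (p^-1 j, p^-1 i); rewrite -H !inE /= ps !permKV ij andbT /= andbT.
  move: fs; rewrite /f !permM !permE /=.
  by have := ltn_ord (s (p^-1 i)); have := ltn_ord (s (p^-1 j)); lia.
- case/andP=> /andP[ij ss] /andP[_ ps].
  have kp u : p^-1 (p u) = u := permK p u.
  have := in_set0 (p j, p i); rewrite -H !inE /= ps !kp ij andbT /= andbT.
  rewrite /f !permM !kp ![w _]permE /=.
  by have := ltn_ord (s i); have := ltn_ord (s j); lia.
Qed.
End NonNudgable.

(** * Random pairs preserving a common subset or partition *)

Section FixedPairs.
Local Open Scope group_scope.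
Variables (gT : finGroupType) (rT : finType) (to : {action gT &-> rT}) (O : {set rT}).
Hypothesis orbO : forall z, z \in O -> orbit to [set: gT] z = O.

(* The stabiliser of each of the [#|O|] points has density [1 / #|O|] in the group. *)
Lemma card_pairs_fixing :
  #|[set st : gT * gT | [exists z in O, (to z st.1 == z) && (to z st.2 == z)]]| * #|O| <= #|gT| ^ 2.
Proof.
have st z : z \in O -> (#|O| * #|'C[z | to]|)%N = #|gT|.
  by move=> zO; rewrite -(orbO zO) -[#|gT|]cardsT -(card_orbit_stab to [set: gT]%G z) setTI.
apply: leq_trans (_ : (\sum_(z in O) #|'C[z | to]| ^ 2) * #|O| <= _).
  rewrite leq_mul2r; apply/orP; right.
  apply: leq_trans (_ : #|\bigcup_(z in O) setX 'C[z | to] 'C[z | to]| <= _).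
    apply: subset_leq_card; apply/subsetP=> -[s t]; rewrite inE /= => /exists_inP[z zO /andP[/eqP sz /eqP tz]].
    by apply/bigcupP; exists z => //; rewrite inE; apply/andP; split; apply/astab1P.
  elim/big_rec2: _ => [|z m A _ le]; first by rewrite cards0.
  rewrite -mulnn -cardsX; apply: leq_trans (_ : #|setX 'C[z | to] 'C[z | to]| + #|A| <= _); last by rewrite leq_add2l.
  by case: (leq_card_setU (setX 'C[z | to] 'C[z | to]) A).
have [->|[z0 z0O]] := set_0Vmem O; first by rewrite cards0 muln0.
rewrite (eq_bigr (fun=> #|'C[z0 | to]| ^ 2)%N) => [|z zO]; last first.
  by congr (_ ^ 2)%N; apply/eqP; have := st z zO; rewrite -(st z0 z0O) => /eqP; rewrite eqn_pmul2l // (cardD1 z) zO.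
rewrite sum_nat_const -(st z0 z0O); lia.
Qed.
End FixedPairs.

Section Structures.
Local Open Scope group_scope.
Variable T : finType.
Implicit Types (s t g h : {perm T}) (A B S : {set T}) (P Q : {set {set T}}) (G : {group {perm T}}).

Lemma perm_of_uniq (s s' : seq T) : uniq s -> uniq s' -> size s = size s' ->
  exists p : {perm T}, map p s = s'.
Proof.
move=> us us' ss'.
have le : size s <= #|T| by rewrite -(card_uniqP us) max_card.
have tr := ntransitive_weak le (Sym_trans T).
have ds : in_tuple s \in (size s).-dtuple([set: T]) by rewrite inE us; apply/subsetP.
have e : size s' == size s by rewrite ss'.
have ds' : Tuple e \in (size s).-dtuple([set: T]) by rewrite inE us'; apply/subsetP.
have [p _ /(congr1 val) /= ->] := atransP2 tr ds ds'.
by exists p; apply: eq_map => x.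
Qed.

Lemma perm_setactE p A : 'P^*%act A p = p @: A. Proof. by []. Qed.

Definition ksets k := [set A : {set T} | #|A| == k].

Lemma ksets_orbit k A : A \in ksets k -> orbit 'P^* [set: {perm T}] A = ksets k.
Proof.
rewrite inE => /eqP Ak; apply/setP=> B; rewrite inE; apply/orbitP/eqP => [[p _ <-]|Bk].
  by rewrite perm_setactE card_imset_perm.
have [|p] := perm_of_uniq (enum_uniq A) (enum_uniq B); first by rewrite -!cardE Ak Bk.
move=> e; exists p; rewrite ?inE // perm_setactE; apply/setP=> z.
by rewrite -[RHS]mem_enum -e; apply/imsetP/mapP => -[u uA ->]; exists u => //; move: uA; rewrite ?mem_enum.
Qed.

Lemma card_pairs_kset k :
  #|[set st : {perm T} * {perm T} | [exists A in ksets k, (st.1 @: A == A) && (st.2 @: A == A)]]| * 'C(#|T|, k)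
  <= #|{perm T}| ^ 2.
Proof.
rewrite -card_draws; exact: (card_pairs_fixing (@ksets_orbit k)).
Qed.

Definition uniform_partitions b :=
  [set P : {set {set T}} | partition P [set: T] && [forall A in P, #|A| == b]].

Definition impart s P := [set s @: (A : {set T}) | A in P].

Lemma perm_setact2E p P : 'P^*^*%act P p = impart p P. Proof. by []. Qed.

(** Concatenating the blocks lists every point once, so some permutation carries one list to the
    other; as all blocks have size [b], it carries block to block. *)
Lemma uniform_partitions_orbit b P : 0 < b -> P \in uniform_partitions b ->
  orbit 'P^*^* [set: {perm T}] P = uniform_partitions b.
Proof.
move=> b0; rewrite inE => /andP[pP /forall_inP sP].
have cP Q : partition Q [set: T] -> {in Q, forall A, #|A| == b} -> (#|Q| * b)%N = #|T|.
  by move=> pQ sQ; rewrite -cardsT (@card_uniform_partition _ b Q _ _ pQ) // => A /sQ/eqP.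
pose blocks Q : seq (seq T) := [seq enum (A : {set T}) | A <- enum Q].
have shape_blocks Q : {in Q, forall A, #|A| == b} -> shape (blocks Q) = nseq #|Q| b.
  move=> sQ; rewrite /shape -map_comp cardE; set z := map _ _; have /all_pred1P -> : all (pred1 b) z.
    by rewrite all_map; apply/allP=> A; rewrite mem_enum /= -cardE => /sQ.
  by rewrite size_map.
have uniq_blocks Q : partition Q [set: T] -> {in Q, forall A, #|A| == b} -> uniq (flatten (blocks Q)).
  move=> pQ sQ; apply: (leq_size_uniq (enum_uniq T)) => [x _|].
    have : x \in cover Q by rewrite (cover_partition pQ) inE.
    case/bigcupP=> A AQ xA; apply/flattenP; exists (enum A); last by rewrite mem_enum.
    by apply: map_f; rewrite mem_enum.
  by rewrite size_flatten shape_blocks // sumn_nseq -cardE -(cP Q) // mulnC.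
apply/setP=> Q; rewrite inE; apply/orbitP/andP => [[p _ <-]|[pQ /forall_inP sQ]].
  rewrite perm_setact2E; split.
    have -> : [set: T] = p @: [set: T] by apply/setP=> z; rewrite mem_imset_perm !inE.
    by rewrite imset_partition //; exact: perm_inj.
  by apply/forall_inP=> _ /imsetP[A AP ->]; rewrite card_imset_perm sP.
have ePQ : #|P| = #|Q| by apply/eqP; rewrite -(eqn_pmul2r b0) !cP.
have [|p e] := perm_of_uniq (uniq_blocks P pP sP) (uniq_blocks Q pQ sQ).
  by rewrite !size_flatten !shape_blocks // ePQ.
exists p; rewrite ?inE // perm_setact2E; apply/setP=> B.
have {}e : map (map p) (blocks P) = blocks Q.
  apply: eq_from_flatten_shape; first by rewrite -map_flatten.
  rewrite shape_blocks // -ePQ -(shape_blocks P) // /shape -map_comp.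
  by apply: eq_map => z /=; rewrite size_map.
have /(congr1 (map (fun z : seq T => [set x in z]))) := e.
have -> : map (fun z : seq T => [set x in z]) (blocks Q) = enum Q.
  rewrite -map_comp -[RHS]map_id; apply: eq_map => A.
  by apply/setP=> z; rewrite /= inE mem_enum.
rewrite -!map_comp => e2; rewrite -[RHS]mem_enum -e2.
have e3 A : [set x in [seq p i | i <- enum A]] = p @: A.
  apply/setP=> z; rewrite inE.
  by apply/mapP/imsetP => -[u uA ->]; exists u => //; move: uA; rewrite ?mem_enum.
by apply/imsetP/mapP => -[A AP ->]; exists A; rewrite /= ?e3 //; move: AP; rewrite ?mem_enum.
Qed.

(** Each [b]-set containing a fixed point [x0] is the block of [x0] in some translate of [P], and
    there are ['C(#|T|.-1, b.-1)] such sets. *)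
Lemma card_uniform_partitions_ge b P : 0 < b -> P \in uniform_partitions b ->
  'C(#|T|.-1, b.-1) <= #|uniform_partitions b|.
Proof.
move=> b0 Pb; have := Pb; rewrite inE => /andP[pP /forall_inP sP].
have [x0 _|T0] := pickP [pred x : T | true]; last first.
  have T00 : #|T| = 0 by apply: eq_card0 => x; have := T0 x.
  rewrite T00 /=; apply: leq_trans (_ : #|[set P]| <= _); last by apply: subset_leq_card; rewrite sub1set.
  by rewrite cards1 bin0n; case: eqP.
have <- : #|[set~ x0]| = #|T|.-1 by rewrite cardsC1.
rewrite -cards_draws -(card_in_imset (f := fun A => x0 |: A)); last first.
  move=> A B; rewrite !inE => /andP[A0 _] /andP[B0 _] AB; apply/setP=> z.
  have := congr1 (fun C : {set T} => z \in C) AB; rewrite /= !in_setU1.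
  have [->|//] := eqVneq z x0.
  by move: A0 B0; rewrite ![_ \subset [set~ _]]subsetC !sub1set !inE => /negPf-> /negPf->.
apply: leq_trans (leq_imset_card (fun Q => pblock Q x0) _); apply: subset_leq_card.
apply/subsetP=> S /imsetP[A]; rewrite inE => /andP[A0 /eqP cA] eS.
have cS : #|S| == b.
  by move: A0; rewrite eS subsetC sub1set inE cardsU1 cA => ->; rewrite add1n prednK.
have x0S : x0 \in S by rewrite eS in_setU1 eqxx.
have x0P : x0 \in cover P by rewrite (cover_partition pP) inE.
have B0 : pblock P x0 \in ksets b by rewrite inE sP ?pblock_mem.
have : S \in ksets b by rewrite inE.
rewrite -(ksets_orbit B0) => /orbitP[p _ e].
have : 'P^*^*%act P p \in uniform_partitions b.
  by rewrite -(uniform_partitions_orbit b0 Pb); apply: mem_orbit; rewrite inE.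
move=> Qb; apply/imsetP; exists ('P^*^*%act P p) => //.
move: Qb; rewrite inE => /andP[pQ _].
rewrite (def_pblock (B := S)) //; first by case/and3P: pQ.
by rewrite perm_setact2E -e; apply: imset_f; exact: pblock_mem.
Qed.

Lemma card_pairs_uniform_partition b : 0 < b ->
  #|[set st : {perm T} * {perm T} |
     [exists P in uniform_partitions b, (impart st.1 P == P) && (impart st.2 P == P)]]| * 'C(#|T|.-1, b.-1)
  <= #|{perm T}| ^ 2.
Proof.
move=> b0; set X := [set st | _].
have [e0|[P Pb]] := set_0Vmem (uniform_partitions b).
  suff -> : X = set0 by rewrite cards0.
  by apply/setP=> st; rewrite !inE; apply/exists_inP => -[P]; rewrite e0 inE.
apply: leq_trans (card_pairs_fixing (fun P => @uniform_partitions_orbit b P b0)).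
by apply: leq_mul => //; exact: (card_uniform_partitions_ge b0 Pb).
Qed.

Definition transitive_group G := [forall u, forall v, exists g in G, (g : {perm T}) u == v].

Lemma intransitive_fixes_set (s t : {perm T}) : ~~ transitive_group <<[set s; t]>> ->
  exists2 k, 0 < k <= #|T|./2 & [exists A in ksets k, (s @: A == A) && (t @: A == A)].
Proof.
set G := <<_>>%G; case/forallPn=> u /forallPn[v /exists_inPn nuv].
pose A := orbit 'P G u.
have fixA g : g \in G -> g @: A = A.
  by move=> Gg; apply: etrans (setact_orbit 'P G u g) _; rewrite conjGid // (orbit_act 'P u Gg).
have Gs : s \in G by rewrite mem_gen // !inE eqxx.
have Gt : t \in G by rewrite mem_gen // !inE eqxx orbT.
have uA : u \in A by exact: orbit_refl.
have vA : v \notin A by apply/negP=> /orbitP[g Gg /eqP]; apply/negP; exact: nuv.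
have fixC g : g \in G -> g @: (~: A) = ~: A.
  by move=> Gg; apply/setP=> z; rewrite mem_imset_perm !inE -mem_imset_perm fixA.
have cA := cardsC A.
have A0 : 0 < #|A| by rewrite (cardD1 u) uA.
have C0 : 0 < #|~: A| by rewrite (cardD1 v) inE vA.
have half m k : (m + k)%N = #|T| -> 0 < m -> 0 < k -> 0 < m <= #|T|./2 \/ 0 < k <= #|T|./2 by lia.
have [H|H] := half _ _ cA A0 C0.
  by exists #|A| => //; apply/exists_inP; exists A; rewrite ?inE // !fixA ?eqxx.
by exists #|~: A| => //; apply/exists_inP; exists (~: A); rewrite ?inE // !fixC ?eqxx.
Qed.

Definition has_no_blocks G := [forall B : {set T}, (1 < #|B| < #|T|) ==>
  [exists g in G, (g @: B != B) && (g @: B :&: B != set0)]].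

Lemma has_no_blocksP G : has_no_blocks G -> no_blocks G.
Proof.
move=> /forallP H B cB; have /implyP/(_ cB)/exists_inP[g Gg Hg] := H B.
by exists g.
Qed.

(** The translates of a block [B] are equal or disjoint and cover by transitivity. As [B] is proper
    there are at least two of them, so [#|B|] is at most half of [#|T|]. *)
Lemma imprimitive_fixes_partition (s t : {perm T}) :
  transitive_group <<[set s; t]>> -> ~~ has_no_blocks <<[set s; t]>> ->
  exists2 b, 1 < b <= #|T|./2 &
    [exists P in uniform_partitions b, (impart s P == P) && (impart t P == P)].
Proof.
set G := <<_>>%G => trG /forallPn[B]; rewrite negb_imply => /andP[cB /exists_inPn blk].
pose P := orbit 'P^* G B.
have memP g : g \in G -> g @: B \in P by move=> Gg; rewrite -perm_setactE mem_orbit.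
have fixP g : g \in G -> impart g P = P.
  by move=> Gg; apply: etrans (setact_orbit 'P^* G B g) _; rewrite conjGid // (orbit_act 'P^* B Gg).
have Gs : s \in G by rewrite mem_gen // !inE eqxx.
have Gt : t \in G by rewrite mem_gen // !inE eqxx orbT.
have cP A : A \in P -> #|A| = #|B|.
  by case/orbitP=> g _ <-; rewrite perm_setactE card_imset_perm.
have [x0 x0B] : exists x, x \in B by apply/card_gt0P; lia.
have partP : partition P [set: T].
  apply/and3P; split.
  - apply/eqP/setP=> z; rewrite inE; apply/bigcupP.
    have /forallP/(_ x0)/forallP/(_ z)/exists_inP[g Gg /eqP <-] := trG.
    by exists (g @: B); [exact: memP | exact: imset_f].
  - apply/trivIsetP=> A1 A2 /orbitP[g Gg <-] /orbitP[h Gh <-]; rewrite !perm_setactE => ne.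
    rewrite -setI_eq0; apply: contraR ne => /set0Pn[z /setIP[zg zh]].
    have Gk : g * h^-1 \in G by rewrite groupM ?groupV.
    have := blk _ Gk; rewrite negb_and !negbK imset_permM => /orP[/eqP e|/eqP/setP/(_ (h^-1 z))].
      by have := imset_permK h^-1 (g @: B); rewrite invgK e => ->.
    by rewrite !inE -[_ \in B]mem_imset_perm zh andbT mem_imset_perm invgK permKV zg.
  - by apply/negP=> /cP; rewrite cards0; lia.
have e := @card_uniform_partition _ #|B| P _ cP partP; rewrite cardsT in e.
exists #|B|.
  by move: cB e; case: #|P| => [|[|m]]; nia.
by apply/exists_inP; exists P; rewrite ?fixP ?eqxx // inE partP; apply/forall_inP=> A /cP ->.
Qed.
End Structures.

(** * Cycle lengths of a random permutation *)

Section CycleCounts.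
Local Open Scope nat_scope.
Variable T : finType.
Implicit Types (s : {perm T}) (x y : T) (w : seq T).

Lemma card_perm_map w w' : uniq w -> uniq w' -> size w = size w' ->
  #|[set s : {perm T} | map s w == w']| = (#|T| - size w)`!.
Proof.
move=> uw uw' sw; have [p pw] := perm_of_uniq uw uw' sw.
pose C : {set T} := [set x | x \notin w].
have cC : #|C| = #|T| - size w.
  have -> : C = ~: [set x in w] by apply/setP=> x; rewrite !inE.
  by rewrite cardsCs setCK cardsE (card_uniqP uw).
have inj : injective (fun s : {perm T} => (s * p)%g) by move=> s t /mulIg.
rewrite -cC -(card_perm C) -[RHS](card_imset _ inj); apply: eq_card => s.
rewrite -(mulgKV p s); rewrite (mem_imset _ _ inj) !inE; move: (s * p^-1)%g => {}s.
apply/eqP/subsetP => [e z|sC].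
  rewrite !inE; apply: contra => zw.
  have := congr1 (fun l => nth z l (index z w)) (etrans e (esym pw)).
  by rewrite !(nth_map z) ?index_mem // nth_index // permM => e2; apply/eqP; exact: (@perm_inj _ p).
rewrite -pw; apply/eq_in_map => z zw; rewrite permM.
by apply: congr1; apply/eqP; apply: contraTT zw => /sC; rewrite inE.
Qed.

(* With [c] rotating a tuple (or both halves of it), such a [w] is a cycle of [s]
   (or a pair of disjoint cycles) with a chosen starting point. *)
Lemma sum_card_tuples k (c : seq T -> seq T) :
  (forall w, size w = k -> uniq w -> uniq (c w) /\ size (c w) = k) ->
  \sum_(s : {perm T}) #|[set w : k.-tuple T | uniq w & map s w == c w]| = (k <= #|T|) * #|T|`!.
Proof.
move=> cP; under eq_bigr => s _ do rewrite -sum1dep_card.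
under eq_bigr => s _ do rewrite big_mkcondr /=.
rewrite exchange_big /=.
rewrite (eq_bigr (fun=> (#|T| - k)`!)) => [|w uw]; last first.
  have [ucw scw] := cP w (size_tuple w) uw.
  rewrite -big_mkcond /= sum1dep_card card_perm_map ?size_tuple //.
rewrite sum_nat_const -[#|_|](card_in_imset (f := id)) //.
have -> : #|[set x | x in (fun w : k.-tuple T => uniq w)]| = #|T| ^_ k.
  rewrite -card_uniq_tuples; apply: eq_card => w.
  apply/imsetP/idP => [[v uv ->]|]; first by rewrite inE; apply/andP; split=> //; exact/allP.
  by rewrite inE => /andP[_ uw]; exists w.
have [le|lt] := leqP k #|T|; first by rewrite ffact_fact // mul1n.
by rewrite ffact_small.
Qed.

Lemma map_rot1_traject s x w z : map s (x :: w) = rcons w z -> x :: w = traject s x (size w).+1.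
Proof.
elim: w x => [|y w IH] x //= [-> e]; congr (_ :: _).
by rewrite [LHS](IH y).
Qed.

Lemma cycle_tuple_porbit s x w : uniq (x :: w) -> map s (x :: w) = rot 1 (x :: w) ->
  #|porbit s x| = (size w).+1.
Proof.
move=> uw; rewrite rot1_cons => e.
have tw := map_rot1_traject e.
rewrite -[RHS]/(size (x :: w)) -(card_uniqP uw); apply: eq_card => y.
apply/porbitP/idP => [[i ->]|].
  elim: i => [|i IH]; first by rewrite perm1 mem_head.
  by rewrite expgSr permM -(mem_rcons w x) -e map_f.
by rewrite tw => /trajectP[i _ ->]; exists i; rewrite permX.
Qed.

Lemma map_traject_porbit s x a : #|porbit s x| = a ->
  map s (traject s x a) = rot 1 (traject s x a).
Proof.
move=> e; have := iter_porbit s x; rewrite e.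
have : 0 < a by rewrite -e lt0n card_porbit_neq0.
case: a {e} => // a _ ia; rewrite /= rot1_cons.
have mt m y : map s (traject s y m) = traject s (s y) m by elim: m y => //= m IH y; rewrite IH.
by rewrite mt -trajectS trajectSr -iterSr ia.
Qed.

(** Taking the first entry injects the [a]-tuples rotated by [s] into the points on cycles of length
    [a], and on average there is one such tuple. *)
Lemma card_points_in_cycles_ge a : 0 < a <= #|T| ->
  #|T|`! <= \sum_(s : {perm T}) #|[set x | #|porbit s x| == a]|.
Proof.
case: a => // a aT; rewrite -[leqLHS]mul1n.
have <- : (a.+1 <= #|T|) = 1 :> nat by case/andP: aT => _ ->.
rewrite -(@sum_card_tuples a.+1 (rot 1)) => [|w sw uw]; last by rewrite rot_uniq size_rot.
apply: leq_sum => s _.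
have inj : {in [set w : a.+1.-tuple T | uniq w & map s w == rot 1 w] &, injective (fun w : a.+1.-tuple T => thead w)}.
  move=> w w'; rewrite !inE; case/tupleP: w => x w; case/tupleP: w' => x' w'.
  rewrite !theadE => /andP[_ /eqP ew] /andP[_ /eqP ew'] exx; rewrite -{x'}exx in ew' *.
  apply: val_inj => /=; move: ew ew'; rewrite /= !rot1_cons => /map_rot1_traject -> /map_rot1_traject ->.
  by rewrite !size_tuple.
rewrite -(card_in_imset inj); apply: subset_leq_card; apply/subsetP=> _ /imsetP[w + ->].
case/tupleP: w => x w; rewrite !inE theadE => /andP[uw /eqP ew].
by rewrite (@cycle_tuple_porbit s x w) // size_tuple.
Qed.

(** Concatenating the traversals of both cycles injects these pairs of points into the
    [(a + b)]-tuples whose two parts [s] rotates. *)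
Lemma card_points_in_two_cycles_le a b : 0 < a -> 0 < b ->
  \sum_(s : {perm T}) #|[set xy : T * T |
      [&& #|porbit s xy.1| == a, #|porbit s xy.2| == b & xy.2 \notin porbit s xy.1]]| <= #|T|`!.
Proof.
move=> a0 b0; pose c (w : seq T) := rot 1 (take a w) ++ rot 1 (drop a w).
have cP w : size w = a + b -> uniq w -> uniq (c w) /\ size (c w) = a + b.
  move=> sw uw; have pc : perm_eq (c w) w.
    by rewrite -[X in perm_eq _ X](cat_take_drop a w); apply: perm_cat; rewrite perm_rot.
  by rewrite (perm_uniq pc) (perm_size pc).
apply: leq_trans (_ : (a + b <= #|T|) * #|T|`! <= _); last by rewrite -[leqRHS]mul1n leq_mul2r leq_b1 orbT.
rewrite -(sum_card_tuples cP); apply: leq_sum => s _.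
have st x y : size (traject s x a ++ traject s y b) == a + b by rewrite size_cat !size_traject.
pose f (xy : T * T) : (a + b).-tuple T := Tuple (st xy.1 xy.2).
have inj : injective f.
  move=> [x y] [x' y'] /(congr1 val) /= /eqP; rewrite eqseq_cat ?size_traject // => /andP[].
  by case: {st f c cP} a a0 => // a _; case: b b0 => // b _ /eqP[-> _] /eqP[-> _].
rewrite -(card_imset _ inj); apply: subset_leq_card; apply/subsetP=> _ /imsetP[[x y] + ->].
rewrite !inE /= => /and3P[/eqP xa /eqP yb yx].
have tk : take a (traject s x a ++ traject s y b) = traject s x a by rewrite take_size_cat ?size_traject.
have dr : drop a (traject s x a ++ traject s y b) = traject s y b by rewrite drop_size_cat ?size_traject.
rewrite /c tk dr map_cat !map_traject_porbit // eqxx andbT cat_uniq -{1}xa -{2}yb !uniq_traject_porbit /= andbT.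
apply/hasPn=> z; rewrite -yb -porbit_traject => zy; rewrite -xa -porbit_traject.
apply: contra yx => zx; rewrite -!eq_porbit_mem in zx zy *; rewrite -(eqP zy); exact: zx.
Qed.
End CycleCounts.

(** * Second moment of the number of cycles with length in a given set *)

Section SecondMoment.
Local Open Scope ring_scope.
Variables (R : realFieldType) (T : finType) (Q : seq nat).
Hypothesis uQ : uniq Q.
Hypothesis Q0 : forall a, a \in Q -> (0 < a)%N.
Implicit Types (s : {perm T}) (x y : T).

Let len s x := #|porbit s x|.
Let N : R := (#|T|`!)%:R.
Let mu : R := \sum_(a <- Q) a%:R^-1.
(* Each cycle of [s] of length in [Q] contributes 1 to [ncycles s], spread over its points. *)
Let weight (m : nat) : R := \sum_(a <- Q) (m == a)%:R * a%:R^-1.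
Let ncycles s := \sum_x weight (len s x).

Lemma weightE m : weight m = if m \in Q then m%:R^-1 else 0.
Proof.
rewrite /weight; case: ifP => mQ.
  rewrite (bigD1_seq m) //= eqxx mul1r big1 ?addr0 // => a am.
  by rewrite eq_sym (negPf am) mul0r.
rewrite big_seq big1 // => a aQ; case: eqP => [e|]; last by rewrite mul0r.
by rewrite e aQ in mQ.
Qed.

Lemma card_natr (U : finType) (P : pred U) : #|[set u | P u]|%:R = \sum_u (P u)%:R :> R.
Proof. by rewrite -sum1dep_card natr_sum big_mkcond; apply: eq_bigr => u _; case: (P u). Qed.

Lemma sum_ncycles_ge : (forall a, a \in Q -> (a <= #|T|)%N) -> N * mu <= \sum_(s : {perm T}) ncycles s.
Proof.
move=> QT; rewrite /ncycles /weight.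
under eq_bigr => s _ do rewrite exchange_big /=.
rewrite exchange_big /= mulr_sumr big_seq [leRHS]big_seq; apply: ler_sum => a aQ.
under eq_bigr => s _ do rewrite -mulr_suml -card_natr.
rewrite -mulr_suml; apply: ler_wpM2r; first by rewrite invr_ge0 ler0n.
by rewrite -natr_sum ler_nat; apply: card_points_in_cycles_ge; rewrite Q0 ?QT.
Qed.

Let pairs s a b : R := #|[set xy : T * T |
      [&& len s xy.1 == a, len s xy.2 == b & xy.2 \notin porbit s xy.1]]|%:R.

Lemma sum_pairs_le a b : (0 < a)%N -> (0 < b)%N -> \sum_(s : {perm T}) pairs s a b <= N.
Proof. by move=> a0 b0; rewrite -natr_sum ler_nat; exact: card_points_in_two_cycles_le. Qed.

(** Two points on the same cycle of length [m] in [Q] contribute [1/m^2]; summed over the [m]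
    choices of the second point this is [1/m] again, which yields the linear term. The remaining
    pairs of points lie on distinct cycles. *)
Lemma sqr_ncycles s : ncycles s ^+ 2 = ncycles s + \sum_(a <- Q) \sum_(b <- Q) a%:R^-1 * b%:R^-1 * pairs s a b.
Proof.
have inner x : \sum_y weight (len s x) * weight (len s y)
   = weight (len s x) + \sum_(y | y \notin porbit s x) weight (len s x) * weight (len s y).
  rewrite (bigID (fun y => y \in porbit s x)) /=; congr (_ + _).
  rewrite (eq_bigr (fun=> weight (len s x) * weight (len s x))) => [|y yx]; last first.
    by congr (_ * weight _); rewrite /len; apply: eq_card => z; move: yx; rewrite -eq_porbit_mem => /eqP ->.
  rewrite sumr_const -/(len s x) weightE; case: ifP => _; last by rewrite mul0r mul0rn.
  rewrite -[LHS]mulr_natl mulrA divff ?mul1r // pnatr_eq0.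
  exact: card_porbit_neq0.
rewrite expr2 {1}/ncycles mulr_suml.
under eq_bigr => x _ do rewrite mulr_sumr inner.
rewrite big_split /=; congr (_ + _).
transitivity (\sum_x \sum_(y | y \notin porbit s x) \sum_(a <- Q) \sum_(b <- Q)
    a%:R^-1 * b%:R^-1 * ((len s x == a)%:R * (len s y == b)%:R) : R).
  apply: eq_bigr => x _; apply: eq_bigr => y _; rewrite /weight mulr_suml.
  apply: eq_bigr => a _; rewrite mulr_sumr; apply: eq_bigr => b _.
  by rewrite mulrACA mulrC.
under [LHS]eq_bigr => x _ do rewrite exchange_big /=.
rewrite exchange_big /=; apply: eq_bigr => a _.
under [LHS]eq_bigr => x _ do rewrite exchange_big /=.
rewrite exchange_big /=; apply: eq_bigr => b _.
rewrite /pairs card_natr mulr_sumr -(pair_bigA _ (fun x y => a%:R^-1 * b%:R^-1 *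
   [&& len s x == a, len s y == b & y \notin porbit s x]%:R)) /=.
apply: eq_bigr => x _; rewrite big_mkcond; apply: eq_bigr => y _.
by case: (y \in _); case: (len s x == a); case: (len s y == b); rewrite /= ?(mul0r, mulr0, mulr1).
Qed.

Lemma sum_sqr_ncycles_le : \sum_(s : {perm T}) ncycles s ^+ 2 <= \sum_(s : {perm T}) ncycles s + N * mu ^+ 2.
Proof.
under eq_bigr => s _ do rewrite sqr_ncycles.
have -> : N * mu ^+ 2 = \sum_(a <- Q) \sum_(b <- Q) a%:R^-1 * b%:R^-1 * N.
  rewrite expr2 /mu mulr_suml mulr_sumr; apply: eq_bigr => a _.
  by rewrite !mulr_sumr; apply: eq_bigr => b _; rewrite mulrC.
rewrite big_split /= lerD2l exchange_big /=.
rewrite big_seq [leRHS]big_seq; apply: ler_sum => a aQ; rewrite exchange_big /=.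
rewrite big_seq [leRHS]big_seq; apply: ler_sum => b bQ.
rewrite -mulr_sumr; apply: ler_wpM2l; first by rewrite mulr_ge0 // invr_ge0 ler0n.
by apply: sum_pairs_le; exact: Q0.
Qed.

(* Chebyshev: the mean of [ncycles] is at least [mu] and its variance at most [mu]. *)
Lemma card_no_cycle_le : (forall a, a \in Q -> (a <= #|T|)%N) -> 1 <= 2 * mu ->
  #|[set s : {perm T} | [forall x, len s x \notin Q]]|%:R * mu <= N.
Proof.
move=> QT mu1; have mu0 : 0 < mu by lra.
have ncycles0 s : [forall x, len s x \notin Q] -> ncycles s = 0.
  by move=> /forallP H; rewrite /ncycles big1 // => x _; rewrite weightE (negPf (H x)).
have Ns : \sum_(s : {perm T}) 1 = N :> R.
  by rewrite sumr_const -cardsT -[N]/((#|T|`!)%:R) -card_Sym; congr (_ %:R); apply: eq_card => s; rewrite !inE.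
have main : #|[set s : {perm T} | [forall x, len s x \notin Q]]|%:R * mu ^+ 2 <= \sum_(s : {perm T}) (ncycles s - mu) ^+ 2.
  rewrite card_natr mulr_suml; apply: ler_sum => s _.
  by case: (boolP [forall x, _]) => [/ncycles0 ->|_]; rewrite ?mul0r ?sqr_ge0 // mul1r sub0r sqrrN.
have : \sum_(s : {perm T}) (ncycles s - mu) ^+ 2 <= N * mu.
  have -> : \sum_(s : {perm T}) (ncycles s - mu) ^+ 2 = \sum_(s : {perm T}) ncycles s ^+ 2 - 2 * mu * \sum_(s : {perm T}) ncycles s + N * mu ^+ 2.
    rewrite -Ns mulr_sumr mulr_suml -sumrB -big_split /=; apply: eq_bigr => s _.
    by rewrite mul1r; ring.
  have := sum_sqr_ncycles_le; have := sum_ncycles_ge QT.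
  move: (\sum_(s : {perm T}) ncycles s) (\sum_(s : {perm T}) ncycles s ^+ 2) => EX EX2 h1 h2.
  (* With [EX2 <= EX + N * mu ^+ 2], the quantity to bound is at most
     [(1 - 2 * mu) * EX + 2 * N * mu ^+ 2]. This decreases in [EX], so [EX] may be replaced by its
     lower bound [N * mu]. *)
  have : 0 <= (2 * mu - 1) * (EX - N * mu) by rewrite mulr_ge0 //; lra.
  by nra.
move=> /(le_trans main); rewrite expr2 mulrA ler_pM2r //.
Qed.

Lemma card_resonant_le :
  #|[set s : {perm T} | [exists x, (len s x \in Q) &&
      [exists y, (y \notin porbit s x) && (len s x %| len s y)%N]]]|%:R
  <= N * \sum_(a <- Q) \sum_(1 <= k < #|T|.+1) (a%:R ^+ 2 * k%:R)^-1.
Proof.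
(* A resonant pair of cycles of lengths [a] and [k * a] yields [a * (k * a)] pairs of points. *)
pose F s : R := \sum_(a <- Q) \sum_(1 <= k < #|T|.+1) (a%:R * (k * a)%:R)^-1 * pairs s a (k * a).
have pairs0 s a b : 0 <= pairs s a b by rewrite ler0n.
have term0 s a k : 0 <= (a%:R * (k * a)%:R)^-1 * pairs s a (k * a).
  by rewrite mulr_ge0 // invr_ge0 mulr_ge0 // ler0n.
apply: le_trans (_ : \sum_(s : {perm T}) F s <= _); last first.
  rewrite exchange_big /= mulr_sumr big_seq [leRHS]big_seq; apply: ler_sum => a aQ.
  rewrite exchange_big /= mulr_sumr big_nat [leRHS]big_nat; apply: ler_sum => k /andP[k0 _].
  rewrite -mulr_sumr mulrC natrM (mulrC k%:R) mulrA -expr2.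
  apply: ler_wpM2r; first by rewrite invr_ge0 mulr_ge0 ?exprn_ge0 // ler0n.
  have a0 := Q0 aQ; by apply: sum_pairs_le => //; rewrite muln_gt0 k0.
rewrite card_natr; apply: ler_sum => s _; case: (boolP [exists x, _]) => [|_]; last first.
  by apply: sumr_ge0 => a _; apply: sumr_ge0 => k _.
case/existsP=> x /andP[xQ /existsP[y /andP[yx /dvdnP[k ek]]]].
have lx : (0 < len s x)%N by exact: Q0.
have ly : (0 < len s y)%N by rewrite lt0n card_porbit_neq0.
have k0 : (0 < k)%N by rewrite lt0n; apply: contraTneq ly => k0; rewrite ek k0.
have kT : (k < #|T|.+1)%N.
  rewrite ltnS (leq_trans _ (max_card (mem (porbit s y)))) // -/(len s y) ek leq_pmulr //.
rewrite /F (bigD1_seq (len s x)) //= (bigD1_seq k) /= ?mem_index_iota ?k0 ?kT ?iota_uniq //.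
rewrite -addrA; apply: le_trans (_ : (((len s x)%:R * (k * len s x)%:R)^-1 * pairs s (len s x) (k * len s x)) <= _); last first.
  rewrite lerDl addr_ge0 // ?sumr_ge0 // => a _; first by apply: sumr_ge0 => j _.
rewrite -ek mulrC ler_pdivlMr ?mulr_gt0 ?ltr0n // mul1r -natrM ler_nat -cardsX.
apply: subset_leq_card; apply/subsetP=> -[x' y']; rewrite !inE /= => /andP[xx' yy'].
have ex : porbit s x' = porbit s x by apply/eqP; rewrite eq_porbit_mem.
have ey : porbit s y' = porbit s y by apply/eqP; rewrite eq_porbit_mem.
rewrite /len ex ey eqxx (introT eqP ek) /=; apply: contra yx => y'x.
by rewrite -eq_porbit_mem -ey eq_porbit_mem.
Qed.
End SecondMoment.

(** * Reciprocals of primes *)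

Section EulerProduct.
Local Open Scope ring_scope.
Variable R : realFieldType.

Definition harmonic_sum n : R := \sum_(1 <= m < n.+1) m%:R^-1.

Definition euler_prod y : R := \prod_(0 <= p < y | prime p) (p%:R / p.-1%:R).

Definition smooth y m := all (fun p => p < y)%N (primes m).

Lemma smoothS y m : ~~ prime y -> smooth y.+1 m = smooth y m.
Proof.
move=> npy; apply: eq_in_all => p; rewrite mem_primes => /andP[pp _].
by rewrite ltnS leq_eqVlt; case: eqP => // e; rewrite -e pp in npy.
Qed.

Lemma smoothS_ndvd y m : prime y -> (0 < m)%N -> smooth y.+1 m && ~~ (y %| m)%N = smooth y m.
Proof.
move=> py m0; apply/andP/allP => [[/allP H ndv] p pm|H].
  have := H p pm; rewrite ltnS leq_eqVlt => /orP[/eqP e|//].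
  by move: pm ndv; rewrite mem_primes -e => /and3P[_ _ ->].
split; first by apply/allP=> p /H /ltnW.
by apply/negP=> ym; have := H y; rewrite ltnn mem_primes py m0 ym => /(_ isT).
Qed.

Lemma smooth_mul y d m : (0 < d)%N -> smooth y (d * m)%N -> (0 < m)%N -> smooth y m.
Proof.
move=> d0 /allP H m0; apply/allP=> p; rewrite mem_primes => /and3P[pp _ pm].
by apply: H; rewrite mem_primes pp muln_gt0 d0 m0 dvdn_mull.
Qed.

Definition smooth_sum n y : R := \sum_(1 <= m < n.+1 | smooth y m) m%:R^-1.

Lemma inv_ge0 (m : nat) : 0 <= m%:R^-1 :> R. Proof. by rewrite invr_ge0 ler0n. Qed.
#[local] Hint Resolve inv_ge0 : core.

Lemma smooth_sum_multiples n y : (0 < y)%N ->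
  \sum_(1 <= m < n.+1 | smooth y.+1 m && (y %| m)%N) m%:R^-1 <= y%:R^-1 * smooth_sum n y.+1.
Proof.
move=> y0; rewrite /smooth_sum mulr_sumr.
apply: le_trans (_ : \sum_(1 <= m < n.+1 | smooth y.+1 m && (y %| m)%N)
   \sum_(1 <= i < n.+1 | (y * i == m)%N) m%:R^-1 <= _).
  rewrite big_seq_cond [leRHS]big_seq_cond; apply: ler_sum => m /and3P[mr _ /dvdnP[i e]].
  rewrite mem_index_iota in mr; rewrite big_mkcond (bigD1_seq i) ?iota_uniq //=; last first.
    by rewrite mem_index_iota; move: mr; rewrite e; nia.
  by rewrite e mulnC eqxx lerDl; apply: sumr_ge0 => j _; case: ifP.
rewrite (exchange_big_dep predT) //= [leRHS]big_mkcond big_nat [leRHS]big_nat.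
apply: ler_sum => i /andP[i0 _]; rewrite -invfM -natrM.
case: ifP => sm; last first.
  rewrite big1 // => m /andP[/andP[sm' _] /eqP e]; rewrite -e in sm'.
  by rewrite (smooth_mul y0 sm') in sm.
rewrite big_mkcond; have [yn|yn] := boolP (y * i \in index_iota 1 n.+1); last first.
  rewrite big_seq big1 // => m mr; case: ifP => // /andP[_ /eqP e].
  by rewrite -e (negPf yn) in mr.
rewrite (bigD1_seq (y * i)%N) ?iota_uniq //= big1 ?addr0 => [|m my]; first by case: ifP.
by rewrite [_ == m]eq_sym (negPf my) andbF.
Qed.

(* Euler: a [y.+1]-smooth number is [y]-smooth or [y] times a [y.+1]-smooth number,
   so that [smooth_sum n y.+1 * (1 - 1/y) <= smooth_sum n y] for [y] prime. *)
Lemma smooth_sum_le n y : smooth_sum n y <= euler_prod y.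
Proof.
elim: y => [|y IH].
  rewrite /euler_prod big_geq //; case: n => [|n]; first by rewrite /smooth_sum big_geq // ler01.
  rewrite /smooth_sum big_mkcond big_ltn //= invr1 -[leRHS]addr0 lerD // big_nat big1 // => m /andP[m1 _].
  case: ifP => // /allP H; have := H (pdiv m); rewrite mem_primes pdiv_prime // pdiv_dvd (ltnW m1) /=.
  by move/(_ isT).
rewrite /euler_prod big_mkcond big_nat_recr //= -big_mkcond /= -/(euler_prod y).
have [py|npy] := boolP (prime y); last first.
  rewrite mulr1 (le_trans _ IH) // /smooth_sum le_eqVlt; apply/orP; left; apply/eqP.
  by apply: eq_bigl => m; rewrite smoothS.
have y1 := prime_gt1 py.
have yR : 0 < y.-1%:R :> R by rewrite ltr0n; lia.
have ey : y%:R = y.-1%:R + 1 :> R by rewrite natr1 prednK // ltnW.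
have : smooth_sum n y.+1 <= smooth_sum n y + y%:R^-1 * smooth_sum n y.+1.
  rewrite {1}/smooth_sum (bigID (fun m => y %| m)%N) /= addrC lerD ?smooth_sum_multiples 1?ltnW //.
  rewrite /smooth_sum big_nat_cond [leRHS]big_nat_cond le_eqVlt; apply/orP; left; apply/eqP.
  by apply: eq_bigl => m; case: (boolP (0 < m < n.+1)%N) => //= /andP[m0 _]; rewrite smoothS_ndvd.
move: (smooth_sum n y.+1) (smooth_sum n y) IH => A B IH.
have y0 : 0 < y%:R :> R by rewrite ltr0n ltnW.
rewrite mulrA ler_pdivlMr // => h.
have h2 : A * y%:R <= B * y%:R + A.
  by have := ler_wpM2r (ltW y0) h; rewrite mulrDl mulrAC mulVf ?mul1r ?gt_eqF.
apply: le_trans (_ : B * y%:R <= _); last by rewrite ler_wpM2r // ltW.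
by move: h2; rewrite {1}ey; lra.
Qed.

Lemma harmonic_le_euler_prod n : harmonic_sum n <= euler_prod n.+1.
Proof.
apply: le_trans (smooth_sum_le n _); rewrite /harmonic_sum /smooth_sum big_nat_cond [leRHS]big_nat_cond.
rewrite le_eqVlt; apply/orP; left; apply/eqP; apply: eq_bigl => m.
case: (boolP (0 < m < n.+1)%N) => //= /andP[m0 mn]; symmetry; apply/allP=> p.
by rewrite mem_primes => /and3P[_ _ /dvdn_leq -/(_ m0)]; lia.
Qed.

Lemma euler_prodS y : euler_prod y.+1 = euler_prod y * (if prime y then y%:R / y.-1%:R else 1).
Proof. by rewrite /euler_prod big_mkcond big_nat_recr //= -big_mkcond. Qed.

Lemma euler_factor_ge1 y : 1 <= (if prime y then y%:R / y.-1%:R else 1) :> R.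
Proof.
case: ifP => // /prime_gt1 y1; rewrite ler_pdivlMr ?ltr0n; last by lia.
by rewrite mul1r ler_nat leq_pred.
Qed.

Lemma euler_prod_gt0 y : 0 < euler_prod y.
Proof.
elim: y => [|y IH]; first by rewrite /euler_prod big_geq // ltr01.
by rewrite euler_prodS mulr_gt0 // (lt_le_trans ltr01) // euler_factor_ge1.
Qed.

(* Even when every odd number is treated as a prime, the square of the product of
   the (2i+1)/(2i) is dominated by a telescoping product. *)
Lemma euler_prod_sqr_le j : (0 < j)%N -> euler_prod (2 * j).+2 ^+ 2 <= 4 * (2 * j).+1%:R.
Proof.
elim: j => // j IH _; have [->|j0] := posnP j.
  rewrite /euler_prod !big_mkcond /= /index_iota /= !big_cons big_nil /=.
  by rewrite !mul1r; lra.
have -> : (2 * j.+1).+2 = (2 * j).+4 by lia.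
rewrite 2!euler_prodS.
have -> : prime (2 * j).+2 = false.
  apply/negP=> /primeP[_ /(_ 2)]; rewrite (_ : (2 * j).+2 = 2 * j.+1)%N ?dvdn_mulr //; last by lia.
  by move/(_ isT) => /orP[//|/eqP]; lia.
rewrite mulr1 exprMn; have {}IH := IH j0.
set E := euler_prod _ in IH *; set f : R := if _ then _ else _.
have f1 : 1 <= f by exact: euler_factor_ge1.
have fle : f <= (2 * j).+3%:R / (2 * j).+2%:R.
  rewrite /f; case: ifP => // _; rewrite ler_pdivlMr ?ltr0n // mul1r ler_nat; lia.
have x0 : 0 < (2 * j).+2%:R :> R by rewrite ltr0n.
have e1 : (2 * j).+1%:R = (2 * j).+2%:R - 1 :> R by rewrite -[(2 * j).+2%:R]natr1; lra.
have e3 : (2 * j).+3%:R = (2 * j).+2%:R + 1 :> R by rewrite natr1.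
rewrite (_ : (2 * j.+1).+1 = (2 * j).+3) ?e3; last by lia.
move: fle IH; rewrite e1 e3; move: x0; move: ((2 * j).+2%:R : R) => x x0 fle IH.
have E0 : 0 <= E ^+ 2 by exact: sqr_ge0.
have f2 : f ^+ 2 * x ^+ 2 <= (x + 1) ^+ 2.
  rewrite -exprMn ler_sqr ?nnegrE ?mulr_ge0 ?(ltW x0) ?(le_trans ler01 f1) //; last by lra.
  by rewrite -ler_pdivlMr.
rewrite -(ler_pM2r (exprn_gt0 2 x0)).
have step : E ^+ 2 * (f ^+ 2 * x ^+ 2) <= 4 * (x - 1) * (x + 1) ^+ 2.
  by apply: ler_pM => //; rewrite mulr_ge0 ?sqr_ge0.
rewrite -mulrA; apply: le_trans step _.
have -> : 4 * (x - 1) * (x + 1) ^+ 2 = 4 * (x + 1) * (x ^+ 2 - 1) by ring.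
by apply: ler_wpM2l; [lra | rewrite gerBl].
Qed.

Lemma euler_prod_split L U : (L <= U)%N -> euler_prod U.+1 =
  euler_prod L.+1 * \prod_(p <- [seq p <- index_iota L.+1 U.+1 | prime p]) (p%:R / p.-1%:R).
Proof.
by move=> LU; rewrite big_filter /euler_prod -(big_cat_nat _ (n := L.+1)).
Qed.

Lemma sum_inv_sqr_le L U : (0 < L)%N ->
  \sum_(p <- [seq p <- index_iota L.+1 U.+1 | prime p]) (p%:R ^+ 2)^-1 <= L%:R^-1 :> R.
Proof.
move=> L0; rewrite big_filter big_mkcond /=.
apply: le_trans (_ : \sum_(L.+1 <= p < U.+1) (p.-1%:R^-1 - p%:R^-1) <= _).
  rewrite big_nat [leRHS]big_nat; apply: ler_sum => p /andP[Lp _].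
  have p0 : 0 < p%:R :> R by rewrite ltr0n; lia.
  have p1 : 0 < p.-1%:R :> R by rewrite ltr0n; lia.
  have ep : p%:R = p.-1%:R + 1 :> R by rewrite natr1 prednK //; lia.
  have e : p.-1%:R^-1 - p%:R^-1 = (p.-1%:R * p%:R)^-1 :> R.
    by rewrite ep; field; rewrite -ep !gt_eqF.
  rewrite e; case: ifP => _; last by rewrite invr_ge0 mulr_ge0 // ltW.
  by rewrite lef_pV2 ?posrE ?exprn_gt0 ?mulr_gt0 // expr2 ler_pM2r // ler_nat leq_pred.
have [LU|UL] := leqP L.+1 U.+1; last by rewrite big_geq // ltnW.
rewrite (eq_bigr (fun p => - p%:R^-1 - - p.-1%:R^-1)) => [|p _]; last by rewrite opprK addrC.
rewrite big_nat_cond (eq_bigr (fun p => (fun q => - q.-1%:R^-1 : R) p.+1 - (fun q => - q.-1%:R^-1 : R) p)) => [|p _ //].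
by rewrite -big_nat_cond telescope_sumr // opprK addrC lerBlDr lerDl.
Qed.

Lemma harmonic_doubling n : (0 < n)%N ->
  harmonic_sum n + 2^-1 <= harmonic_sum (2 * n) <= harmonic_sum n + 1.
Proof.
move=> n0; rewrite {2 3}/harmonic_sum (@big_cat_nat _ _ _ n.+1) //=; last by lia.
rewrite -/(harmonic_sum n) !lerD2l.
have cst (c : R) : \sum_(n.+1 <= m < (2 * n).+1) c = n%:R * c.
  by rewrite big_const_nat iter_addr addr0 mulr_natl; congr (_ *+ _); lia.
have nR : 0 < n%:R :> R by rewrite ltr0n.
apply/andP; split.
  have -> : 2^-1 = \sum_(n.+1 <= m < (2 * n).+1) (2 * n)%:R^-1 :> R.
    by rewrite cst natrM invfM mulrCA divff ?mulr1 // gt_eqF.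
  rewrite [leLHS]big_nat [leRHS]big_nat; apply: ler_sum => m /andP[m1 m2].
  by rewrite lef_pV2 ?posrE ?ltr0n ?ler_nat //; lia.
have e : 1 = \sum_(n.+1 <= m < (2 * n).+1) n%:R^-1 :> R by rewrite cst divff // gt_eqF.
rewrite [leRHS]e [leLHS]big_nat [leRHS]big_nat; apply: ler_sum => m /andP[m1 m2].
by rewrite lef_pV2 ?posrE ?ltr0n ?ler_nat //; lia.
Qed.

Lemma harmonic_exp2 j : 1 + j%:R / 2 <= harmonic_sum (2 ^ j) <= 1 + j%:R.
Proof.
elim: j => [|j /andP[lo hi]].
  by rewrite expn0 /harmonic_sum big_nat1 invr1 mul0r addr0 lexx.
have /andP[h1 h2] := harmonic_doubling (expn_gt0 2 j).
rewrite expnS; apply/andP; split.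
  by apply: le_trans h1; rewrite -natr1; lra.
by apply: le_trans h2 _; rewrite -natr1; lra.
Qed.

Lemma harmonic_mono m n : (m <= n)%N -> harmonic_sum m <= harmonic_sum n.
Proof.
move=> mn; rewrite {2}/harmonic_sum (@big_cat_nat _ _ _ m.+1) //= lerDl.
by apply: sumr_ge0.
Qed.
End EulerProduct.

(** * Generic pairs generate the symmetric group *)

Lemma leq_bin2_bin m k : 1 < k -> k <= m - 2 -> 'C(m, 2) <= 'C(m, k).
Proof.
elim: m k => [|m IH] k k1 km; first by lia.
have [->|k2] := eqVneq k 2; first by [].
have [->|km2] := eqVneq k (m.+1 - 2); first by rewrite bin_sub //; lia.
case: k k1 km k2 km2 => // k k1 km k2 km2; rewrite !binS.
have h1 : 'C(m, 2) <= 'C(m, k.+1) by apply: IH; lia.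
have h2 : 'C(m, 2) <= 'C(m, k) by apply: IH; lia.
apply: leq_add => //; apply: leq_trans h2.
have m3 : 3 <= m by lia.
by rewrite bin1 bin2 -{1}(half_bit_double m false) half_leq //= -muln2 leq_mul2l; lia.
Qed.

Section Bounds.
Local Open Scope ring_scope.
Variable R : realFieldType.

(** The term [k = 1] is [1/m]; the others, fewer than [m], are each at most [1 / 'C(m, 2)] and add
    up to at most [2/(m-1)]. *)
Lemma sum_inv_bin_le m K : (2 < m)%N -> (K <= m - 2)%N ->
  \sum_(1 <= k < K.+1) 'C(m, k)%:R^-1 <= 3 / m.-1%:R :> R.
Proof.
move=> m2 Km.
have m1 : 0 < m.-1%:R :> R by rewrite ltr0n; lia.
have em : m%:R = m.-1%:R + 1 :> R by rewrite natr1 prednK //; lia.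
case: K Km => [|K] Km; first by rewrite big_geq // divr_ge0 // ler0n.
rewrite big_ltn // bin1.
have eC : 'C(m, 2)%:R = m%:R * m.-1%:R / 2 :> R.
  have : ((m * m.-1) = 'C(m, 2) * 2)%N by have := bin_ffact m 2; rewrite ffactnS ffactn1 => <-.
  move/(congr1 (fun i => i%:R : R)); rewrite !natrM => ->.
  by rewrite mulfK // pnatr_eq0.
have C0 : 0 < 'C(m, 2)%:R :> R by rewrite ltr0n bin_gt0; lia.
have m0 : 0 < m%:R :> R by rewrite ltr0n; lia.
have : \sum_(2 <= k < K.+2) 'C(m, k)%:R^-1 <= m%:R * 'C(m, 2)%:R^-1 :> R.
  apply: le_trans (_ : \sum_(2 <= k < K.+2) 'C(m, 2)%:R^-1 <= _).
    rewrite [leLHS]big_nat [leRHS]big_nat; apply: ler_sum => k /andP[k1 kK].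
    by rewrite lef_pV2 ?posrE ?ltr0n ?bin_gt0 ?ler_nat ?leq_bin2_bin //; lia.
  rewrite big_const_nat iter_addr addr0 -[leLHS]mulr_natl ler_pM2r ?invr_gt0 // ler_nat; lia.
have -> : m%:R * 'C(m, 2)%:R^-1 = 2 / m.-1%:R :> R by rewrite eC; field; rewrite !gt_eqF.
have : m%:R^-1 <= m.-1%:R^-1 :> R by rewrite lef_pV2 ?posrE // ler_nat leq_pred.
by lra.
Qed.

Lemma card_bigunion_le (U : finType) (X : nat -> {set U}) (Y : {set U}) (c : nat -> nat) (a b M : nat) :
  (forall k, (a <= k < b)%N -> (0 < c k)%N /\ (#|X k| * c k <= M)%N) ->
  (forall u, u \in Y -> exists2 k, (a <= k < b)%N & u \in X k) ->
  #|Y|%:R <= M%:R * \sum_(a <= k < b) (c k)%:R^-1 :> R.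
Proof.
move=> cX YX; apply: le_trans (_ : \sum_(a <= k < b) #|X k|%:R <= _).
  rewrite -natr_sum ler_nat -sum1_card.
  have card1 k : #|X k| = (\sum_u (u \in X k))%N by rewrite -sum1_card big_mkcond.
  under [leqRHS]eq_bigr => k _ do rewrite card1.
  rewrite exchange_big /= big_mkcond; apply: leq_sum => u _; case: ifP => // /YX[k kr uk].
  by rewrite (bigD1_seq k) ?mem_index_iota ?iota_uniq //= uk.
rewrite mulr_sumr [leLHS]big_nat [leRHS]big_nat; apply: ler_sum => k /cX[c0 h].
by rewrite ler_pdivlMr ?ltr0n // -natrM ler_nat.
Qed.
End Bounds.

Section Assembly.
Variables (n : nat) (Q : seq nat).
Hypothesis n4 : 4 <= n.
Hypothesis Qprime : {in Q, forall p, prime p}.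
Hypothesis Qsmall : {in Q, forall p, p.-1 ^ 2 < n.-1}.

Let gen (st : 'S_n * 'S_n) := <<[set st.1; st.2]>>%G.

Definition no_cycle_length_in (s : 'S_n) := [forall x, #|porbit s x| \notin Q].
Definition resonant_length_in (s : 'S_n) := [exists x, (#|porbit s x| \in Q) &&
      [exists y, (y \notin porbit s x) && (#|porbit s x| %| #|porbit s y|)]].

Lemma generic_pair_non_nudgable st :
  odd_perm st.1 || odd_perm st.2 -> transitive_group (gen st) -> has_no_blocks (gen st) ->
  ~~ no_cycle_length_in st.1 -> ~~ resonant_length_in st.1 -> non_nudgable (gen st).
Proof.
case: st => s t /= odd_st _ nb /forallPn[x] /negPn xQ /existsPn res.
have [k ek fk] : exists2 k, porbit (s ^+ k)%g x = porbit s x & fixes_outside (porbit s x) (s ^+ k)%g.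
  apply: isolated_prime_cycle; first exact: Qprime.
  move=> z zx; have := res x; rewrite xQ /= => /existsPn/(_ z).
  by rewrite zx.
have Gs : s \in gen (s, t) by rewrite mem_gen // !inE eqxx.
have Gt : t \in gen (s, t) by rewrite mem_gen // !inE eqxx orbT.
have [g Gg og] : exists2 g, g \in gen (s, t) & odd_perm g.
  by case/orP: odd_st => o; [exists s | exists t].
suff -> : gen (s, t) = [set: 'S_n]%G by exact: non_nudgable_setT.
apply: val_inj; apply/setP=> r; rewrite [RHS]inE.
apply: (@sym_criterion _ _ (s ^+ k)%g x g) => //.
- exact: groupX.
- by rewrite ek Qprime.
- by rewrite ek.
- exact: has_no_blocksP.
- by rewrite ek card_ord Qsmall.
Qed.

Definition both_even := [set st : 'S_n * 'S_n | ~~ (odd_perm st.1 || odd_perm st.2)].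
Definition intransitive_pairs := [set st | ~~ transitive_group (gen st)].
Definition imprimitive_pairs := [set st | transitive_group (gen st) && ~~ has_no_blocks (gen st)].
Definition bad_first := [set s : 'S_n | no_cycle_length_in s] :|: [set s : 'S_n | resonant_length_in s].

Lemma card_both_even : 4 * #|both_even| = #|{: 'S_n * 'S_n}|.
Proof.
have -> : both_even = setX (Alt 'I_n) (Alt 'I_n).
  by apply/setP=> -[s t]; rewrite in_setX !Alt_even inE negb_or.
have := @card_Alt 'I_n; rewrite card_ord => /(_ (ltnW (ltnW n4))) e.
by rewrite cardsX card_prod card_Sn -e mulnACA.
Qed.

Lemma card_bad_events : #|{: 'S_n * 'S_n}| <= #|[set st : 'S_n * 'S_n | non_nudgable (gen st)]|
  + #|both_even| + #|intransitive_pairs| + #|imprimitive_pairs| + #|bad_first| * #|{: 'S_n}|.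
Proof.
pose B4 := setX bad_first [set: 'S_n].
have <- : #|B4| = #|bad_first| * #|{: 'S_n}| by rewrite cardsX cardsT.
set Good := [set st | _].
apply: leq_trans (_ : #|Good :|: both_even :|: intransitive_pairs :|: imprimitive_pairs :|: B4| <= _).
  rewrite -cardsT; apply: subset_leq_card; apply/subsetP=> st _; rewrite !inE.
  case: (boolP (odd_perm _ || odd_perm _)) => o; last by rewrite orbT.
  case: (boolP (transitive_group _)) => tr; last by rewrite orbT.
  case: (boolP (has_no_blocks _)) => nb; last by rewrite orbT.
  case: (boolP (no_cycle_length_in _)) => nc; first by rewrite !orbT.
  case: (boolP (resonant_length_in _)) => rs; first by rewrite !orbT.
  by rewrite generic_pair_non_nudgable.
have cU (A B : {set 'S_n * 'S_n}) m : #|A| <= m -> #|A :|: B| <= m + #|B|.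
  by move=> Am; apply: leq_trans (leq_card_setU A B).1 _; rewrite leq_add2r.
apply: (cU); apply: (cU); apply: (cU).
exact: (leq_card_setU _ _).1.
Qed.
End Assembly.

Section Probability.
Local Open Scope ring_scope.
Variable R : realFieldType.

(** The losses are 1/4 for two even permutations, one term each for intransitive and imprimitive
    pairs, and [e] twice: once for the absence of a cycle with length in [Q], of probability at most
    the inverse of the sum of [1/p], and once for resonance. *)
Lemma prob_non_nudgable_ge n (Q : seq nat) (e : R) : (4 <= n)%N -> uniq Q ->
  {in Q, forall p, prime p} -> {in Q, forall p, (p.-1 ^ 2 < n.-1)%N} ->
  1 <= 2 * \sum_(p <- Q) p%:R^-1 :> R -> 1 <= e * \sum_(p <- Q) p%:R^-1 :> R ->
  \sum_(p <- Q) \sum_(1 <= k < n.+1) (p%:R ^+ 2 * k%:R)^-1 <= e :> R ->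
  3 / 4 - 3 / n.-1%:R - 3 / n.-2%:R - e - e <=
  #|[set st : 'S_n * 'S_n | non_nudgable <<[set st.1; st.2]>>%G]|%:R / #|{: 'S_n * 'S_n}|%:R.
Proof.
move=> n4.
have [half1 half2] : (n./2 <= n - 2)%N /\ ((n./2).-1 <= n.-1 - 2)%N by lia.
have in_range k : (0 < k < n./2.+1)%N -> (k <= n)%N by lia.
have in_range' k : (0 < k < (n./2).-1.+1)%N -> (k <= n.-1)%N by lia.
have pred_range b : (1 < b <= n./2)%N -> (0 < b.-1 < (n./2).-1.+1)%N by lia.
have n3 : (2 < n.-1)%N by lia.
move=> uQ Qp Qs mu2 mue sume.
set G := #|[set st | _]|; pose N := #|{: 'S_n}|.
have NN : #|{: 'S_n * 'S_n}| = (N ^ 2)%N by rewrite card_prod mulnn.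
have N0 : 0 < N%:R :> R by rewrite ltr0n; apply/card_gt0P; exists 1%g.
have NE : N = n`!%N by rewrite /N card_Sn.
have Q0 a : a \in Q -> (0 < a)%N by move/Qp/prime_gt0.
have QT a : a \in Q -> (a <= #|'I_n|)%N.
  by move=> aQ; rewrite card_ord; have := Qs a aQ; have := prime_gt1 (Qp a aQ); nia.
have mu0 : 0 < \sum_(p <- Q) p%:R^-1 :> R by lra.
have hnc : #|[set s : 'S_n | no_cycle_length_in Q s]|%:R <= N%:R * e :> R.
  have h := card_no_cycle_le (R := R) (T := 'I_n) uQ Q0 QT mu2.
  rewrite card_ord -NE in h; rewrite -(ler_pM2r mu0); apply: le_trans h _.
  by rewrite -mulrA ler_peMr // ltW.
have hrs : #|[set s : 'S_n | resonant_length_in Q s]|%:R <= N%:R * e :> R.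
  have h := @card_resonant_le R 'I_n Q uQ Q0.
  rewrite card_ord -NE in h; apply: le_trans h _.
  by rewrite ler_pM2l.
have hB4 : #|bad_first n Q|%:R <= N%:R * e + N%:R * e :> R.
  apply: le_trans (lerD hnc hrs); rewrite -natrD ler_nat.
  exact: (leq_card_setU _ _).1.
have hB1 : 4 * #|both_even n|%:R = N%:R ^+ 2 :> R.
  by rewrite -natrX -NN -(card_both_even n4) natrM.
have hB2 : #|intransitive_pairs n|%:R <= N%:R ^+ 2 * (3 / n.-1%:R) :> R.
  apply: le_trans (_ : (N ^ 2)%:R * \sum_(1 <= k < n./2.+1) 'C(n, k)%:R^-1 <= _); last first.
    rewrite natrX ler_pM2l ?exprn_gt0 //; exact: sum_inv_bin_le (ltnW n4) half1.
  apply: (@card_bigunion_le R _ (fun k => [set st : 'S_n * 'S_n |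
     [exists A in ksets 'I_n k, (st.1 @: A == A) && (st.2 @: A == A)]]) _ (fun k => 'C(n, k))).
    move=> k kr; have := card_pairs_kset 'I_n k; rewrite card_ord; split=> //.
    by rewrite bin_gt0 in_range.
  move=> [s t]; rewrite inE => /intransitive_fixes_set [k]; rewrite card_ord => kr H.
  by exists k => //; rewrite inE.
have hB3 : #|imprimitive_pairs n|%:R <= N%:R ^+ 2 * (3 / n.-2%:R) :> R.
  (* Block size [b] is indexed by [k = b - 1], to match the bound ['C(n.-1, b.-1)]. *)
  apply: le_trans (_ : (N ^ 2)%:R * \sum_(1 <= k < (n./2).-1.+1) 'C(n.-1, k)%:R^-1 <= _); last first.
    rewrite natrX ler_pM2l ?exprn_gt0 //; exact: sum_inv_bin_le n3 half2.
  apply: (@card_bigunion_le R _ (fun k => [set st : 'S_n * 'S_n |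
     [exists P in uniform_partitions 'I_n k.+1, (impart st.1 P == P) && (impart st.2 P == P)]]) _ (fun k => 'C(n.-1, k))).
    move=> k kr; have := @card_pairs_uniform_partition 'I_n k.+1 isT; rewrite card_ord; split=> //.
    by rewrite bin_gt0 in_range'.
  move=> [s t]; rewrite inE => /andP[tr /(imprimitive_fixes_partition tr)[b]]; rewrite card_ord => br H.
  exists b.-1; first exact: pred_range.
  by rewrite inE prednK //; case/andP: br => /ltnW.
have := card_bad_events Qp Qs; rewrite NN -(ler_nat R) !natrD natrX natrM -/N.
set g := #|[set st | _]|; have -> : g = G by [].
move=> tot; rewrite ?natrX ler_pdivlMr ?exprn_gt0 //.
have hB4N : #|bad_first n Q|%:R * N%:R <= (N%:R * e + N%:R * e) * N%:R :> R by rewrite ler_pM2r.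
move: hB1 hB2 hB3 hB4N tot.
move: (#|both_even n|%:R : R) (#|intransitive_pairs n|%:R : R) (#|imprimitive_pairs n|%:R : R) => b1 b2 b3.
move: (#|bad_first n Q|%:R : R) (3 / n.-1%:R : R) (3 / n.-2%:R : R) (G%:R : R) => b4 u v gg.
move: (N%:R : R) => z; nra.
Qed.
End Probability.

(** * A window of primes *)

From mathcomp Require Import reals sequences exp.

Section PrimeWindow.
Local Open Scope ring_scope.
Variable R : realType.

Lemma sqrt_window m : exists r : nat, (r ^ 2 <= m < r.+1 ^ 2)%N.
Proof.
elim: m => [|m [r /andP[h1 h2]]]; first by exists 0.
have [e|ne] := eqVneq m.+1 (r.+1 ^ 2)%N; [exists r.+1 | exists r]; nia.
Qed.

(** Each factor satisfies [p/(p-1) <= 1 + 2/p <= expR (2/p)] because [p >= 2]. *)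
Lemma prod_prime_factors_le (Q : seq nat) : {in Q, forall p, prime p} ->
  \prod_(p <- Q) (p%:R / p.-1%:R) <= expR (2 * \sum_(p <- Q) p%:R^-1) :> R.
Proof.
move=> Qp; rewrite mulr_sumr expR_sum big_seq [leRHS]big_seq; apply: ler_prod => p /Qp /prime_gt1 p1.
have y0 : 0 < p.-1%:R :> R by rewrite ltr0n; lia.
have y1 : 1 <= p.-1%:R :> R by rewrite ler1n; lia.
have ep : p%:R = p.-1%:R + 1 :> R by rewrite natr1 prednK // ltnW.
apply/andP; split; first by rewrite divr_ge0 // ler0n.
apply: le_trans (expR_ge1Dx _); rewrite ep; move: (p.-1%:R : R) y0 y1 => y y0 y1.
rewrite ler_pdivrMr // -subr_ge0.
have -> : (1 + 2 * (y + 1)^-1) * y - (y + 1) = (y - 1) / (y + 1) by field; lra.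
by rewrite divr_ge0; lra.
Qed.

(** The harmonic sum up to [U] is at least [(k+2)/4] and at most the Euler product up to [L] times
    [expR (2 * mu)]. Squaring, with [L <= 3 * r^3] and [r^2 <= k+2], gives
    [r^4/16 <= 12 * r^3 * expR (4 * mu)], whence 192. *)
Lemma prime_sum_ge (r k : nat) : (0 < r)%N -> (r ^ 2 <= k.+2)%N -> (0 < k)%N ->
  r%:R <= 192 * expR (4 * \sum_(p <- [seq p <- index_iota (2 * r ^ 3).+2 (2 ^ (k.-1)./2).+1 | prime p]) p%:R^-1) :> R.
Proof.
move=> r0 rk k0; set L := (2 * r ^ 3).+1; set U := (2 ^ _)%N; set Q := [seq p <- _ | _].
set mu := \sum_(p <- Q) _.
have Qp : {in Q, forall p, prime p} by move=> p; rewrite mem_filter => /andP[].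
have HU : k.+2%:R / 4 <= harmonic_sum R U.
  have /andP[h _] := harmonic_exp2 R (k.-1)./2; apply: le_trans h.
  have : (k.+2%:R : R) <= (4 + 2 * (k.-1)./2)%:R by rewrite ler_nat; lia.
  by rewrite natrD natrM; lra.
have HL : euler_prod R L.+1 ^+ 2 <= 4 * L%:R.
  by apply: euler_prod_sqr_le; rewrite expn_gt0 r0.
have HUL : harmonic_sum R U <= euler_prod R L.+1 * expR (2 * mu).
  apply: le_trans (harmonic_le_euler_prod _ _) _.
  have [LU|UL] := leqP L U.
    rewrite (euler_prod_split _ LU); apply: ler_wpM2l; first exact: ltW (euler_prod_gt0 _ _).
    exact: prod_prime_factors_le.
  (* For [U < L] the window is empty, and the Euler product up to [L] already dominates the one up
     to [U]. *)
  have -> : mu = 0 by rewrite /mu /Q /index_iota (_ : U.+1 - L.+1 = 0)%N ?big_nil //; lia.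
  rewrite mulr0 expR0 mulr1 /euler_prod (@big_cat_nat _ _ _ U.+1 0 L.+1) //=; last by lia.
  rewrite ler_peMr ?(ltW (euler_prod_gt0 _ _)) //.
  elim/big_ind: _ => // [x y x1 y1|p pp]; first by rewrite -[1]mulr1 ler_pM.
  by have := euler_factor_ge1 R p; rewrite pp.
have k2 : 0 <= k.+2%:R / 4 :> R by rewrite divr_ge0 ?ler0n.
have /(ler_pM k2 k2 (le_trans HU HUL)) := le_trans HU HUL.
rewrite [leRHS]mulrACA -[expR _ * _]expRD -mulrDl (_ : 2 + 2 = 4); last by lra.
have e0 := expR_gt0 (4 * mu); move: (expR _) e0 => e e0 h.
have {}h : (k.+2%:R / 4) ^+ 2 <= 4 * L%:R * e.
  by rewrite expr2; apply: le_trans h _; rewrite -expr2 ler_pM2r.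
have r1 : 1 <= r%:R :> R by rewrite ler1n.
have kr : r%:R ^+ 2 <= k.+2%:R :> R by rewrite -natrX ler_nat.
have Lr : L%:R <= 3 * r%:R ^+ 3 :> R by rewrite -natrX -(natrM R 3) ler_nat /L; nia.
have r3 : 0 < r%:R ^+ 3 :> R by rewrite exprn_gt0 //; lra.
rewrite -(ler_pM2r r3).
have s1 : (r%:R ^+ 2 / 4) ^+ 2 <= 4 * (3 * r%:R ^+ 3) * e.
  apply: le_trans (_ : (k.+2%:R / 4) ^+ 2 <= _).
    by rewrite ler_sqr ?nnegrE ?divr_ge0 ?exprn_ge0 ?ler0n // ler_pM2r ?invr_gt0 ?ltr0n.
  by apply: le_trans h _; rewrite ler_pM2r // ler_pM2l.
move: s1; have -> : (r%:R ^+ 2 / 4) ^+ 2 = (r%:R * r%:R ^+ 3) / 16 :> R by field.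
by move: (r%:R ^+ 3 : R) => z; lra.
Qed.

Lemma prime_window (e : R) : 0 < e -> exists N0 : nat, forall n, (N0 <= n)%N -> exists Q : seq nat,
  [/\ uniq Q, {in Q, forall p, prime p}, {in Q, forall p, (p.-1 ^ 2 < n.-1)%N},
      1 <= 2 * \sum_(p <- Q) p%:R^-1 :> R /\ 1 <= e * \sum_(p <- Q) p%:R^-1 :> R
    & \sum_(p <- Q) \sum_(1 <= k < n.+1) (p%:R ^+ 2 * k%:R)^-1 <= e :> R].
Proof.
(* A sum of [1/p] above [M] meets both lower bounds on it. In [x], the first summand forces this
   through [prime_sum_ge], and [2 / e] serves the resonance sum. *)
move=> e0; pose M := 1 + e^-1.
have ei : 0 < e^-1 by rewrite invr_gt0.
pose x : R := 192 * expR (4 * M) + 2 / e + 1.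
have x1 : 1 <= x by rewrite lerDr addr_ge0 // ?mulr_ge0 ?expR_ge0 // ltW.
have xb := archi_boundP (le_trans ler01 x1); set r0 := Num.bound x in xb.
exists (2 ^ (r0 ^ 2))%N.+1 => n ln.
have n1 : (1 < n)%N by have := expn_gt0 2 (r0 ^ 2); lia.
(* The primes are taken between about [(log n) ^ (3/2)], which beats the factor
   [log n] of the last sum, and [sqrt n]; [k] approximates [log n] and [r] its square root. *)
pose k := up_log 2 n.
have /andP[kn nk] := up_log_bounds (isT : (1 < 2)%N) n1.
have rk0 : (r0 ^ 2 <= k)%N.
  rewrite -(@leq_exp2l 2) //; apply: leq_trans nk; exact: ltnW.
have k0 : (0 < k)%N by rewrite up_log_gt0.
have [r /andP[rk kr]] := sqrt_window k.+2.
have r0r : (r0 <= r)%N by nia.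
have xr : x < r%:R by apply: lt_le_trans xb _; rewrite ler_nat.
have rpos : (0 < r)%N by rewrite -(ltr0n R); lra.
have := prime_sum_ge rpos rk k0; set Q := [seq p <- _ | _]; set mu := \sum_(p <- Q) _ => hmu.
have muM : M < mu.
  rewrite -(ltr_pM2l (_ : 0 < 4 :> R)) // -ltr_expR.
  have : 0 < 2 / e by rewrite divr_gt0.
  by move: hmu xr; rewrite /x; lra.
exists Q; split.
- by rewrite filter_uniq // iota_uniq.
- by move=> p; rewrite mem_filter => /andP[].
- move=> p; rewrite mem_filter mem_index_iota => /andP[/prime_gt1 p1 /andP[_ pU]].
  have : ((2 ^ (k.-1)./2) ^ 2 < n)%N.
    apply: leq_ltn_trans kn; rewrite -expnM leq_exp2l //; rewrite -/k; lia.
  by move: pU; nia.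
- rewrite -/mu; split; first by move: muM; rewrite /M; lra.
  have := ltW muM; rewrite /M -(ler_pM2l e0) mulrDr divff ?gt_eqF // => h.
  by apply: le_trans h; rewrite lerDr mulr1 ltW.
set L := (2 * r ^ 3).+1 in Q mu muM hmu *.
apply: le_trans (_ : (\sum_(p <- Q) (p%:R ^+ 2)^-1) * harmonic_sum R n <= _).
  rewrite mulr_suml; apply: ler_sum => p _; rewrite mulr_sumr; apply: ler_sum => i _.
  by rewrite invfM.
have hn : harmonic_sum R n <= k.+1%:R.
  apply: le_trans (harmonic_mono R nk) _; have /andP[_] := harmonic_exp2 R k.
  by rewrite -natr1 addrC.
have hn0 : 0 <= harmonic_sum R n by apply: sumr_ge0 => i _; rewrite invr_ge0 ler0n.
have hL := sum_inv_sqr_le R (2 ^ (k.-1)./2) (isT : (0 < L)%N).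
have s0 : 0 <= \sum_(p <- Q) (p%:R ^+ 2)^-1 :> R.
  by apply: sumr_ge0 => i _; rewrite invr_ge0 exprn_ge0 // ler0n.
apply: le_trans (ler_pM s0 hn0 hL hn) _.
have Lpos : 0 < L%:R :> R by rewrite ltr0n.
rewrite mulrC ler_pdivrMr //.
(* This holds as [k + 2 < (r + 1)^2], so the resonance sum is at most
   [(k + 1) / L <= 2 / r <= e]. *)
have : (k.+1 * r <= 2 * L)%N.
  by rewrite /L; nia.
rewrite -(ler_nat R) !natrM => h.
have er : 2 <= e * r%:R.
  have : 2 / e <= r%:R.
    by move: xr; rewrite /x; have := expR_ge0 (4 * M); lra.
  by rewrite ler_pdivrMr // mulrC.
have rR : 0 < r%:R :> R by rewrite ltr0n.
rewrite -(ler_pM2r rR); apply: le_trans h _.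
by have := ler_wpM2r (ltW Lpos) er; lra.
Qed.
End PrimeWindow.

(* Passage to the lower limit *)
From mathcomp Require Import all_classical all_reals all_analysis.

Lemma limn_einf_ge (R : realType) (u : nat -> R) (l : R) :
  (forall e : R, (0 < e)%R -> exists N, forall n, (N <= n)%N -> (l - e <= u n)%R) ->
  (l%:E <= limn_einf (fun n => (u n)%:E))%E.
Proof.
move=> H; apply/lee_addgt0Pr => e e0; have [N HN] := H e e0.
rewrite -leeBlDr // limn_einf_lim; apply: lime_ge; first exact: is_cvg_einfs.
exists N => // m /= Nm; apply: le_ereal_inf_tmp => _ [k /= mk <-].
by rewrite -EFinB lee_fin HN // (leq_trans Nm).
Qed.

Theorem mainTheorem5 (R : realType) :
  ((3 / 4 : R)%:E <= limn_einf (fun n : nat => (prob_non_nudgable R n)%:E))%E.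
Proof.
apply: limn_einf_ge => e e0.
(* Four error terms get [e / 4] each; [3 / m] is that small once [m >= 12 / e]. *)
have e4 : (0 < e / 4)%R by lra.
have [N0 HN0] := prime_window e4.
have b0 : (0 <= 12 / e)%R by rewrite divr_ge0 // ltW.
have bb := archi_boundP b0; set M := Num.bound _ in bb.
exists (N0 + M + 4)%N => n ln.
have [|Q [uQ Qp Qs [mu2 mue] sume]] := HN0 n; first by lia.
have n4 : (4 <= n)%N by lia.
apply: le_trans (prob_non_nudgable_ge n4 uQ Qp Qs mu2 mue sume).
have small m : (M < m)%N -> (3 / m%:R <= e / 4)%R.
  move=> Mm; have mR : (0 < m%:R :> R)%R by rewrite ltr0n; lia.
  have : (12 / e <= m%:R)%R by apply: (le_trans (ltW bb)); rewrite ler_nat ltnW.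
  by rewrite !ler_pdivrMr //; lra.
have h1 : (3 / n.-1%:R <= e / 4)%R by apply: small; lia.
have h2 : (3 / n.-2%:R <= e / 4)%R by apply: small; lia.
by lra.
Qed.
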